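(* Let $(\Gamma,\mu)$ be a stochastic dynamical system on $C([0,1])$ such that $$\mu^{\otimes\mathbb N}\Big(\Big\{(g_1,g_2,\ldots)\in\Gamma^{\mathbb N}:\ \sup_{n\ge 1}\bigvee_0^1 g_1g_2\cdots g_n<\infty\Big\}\Big)>0 .$$ Assume that both of the following conditions hold: $(\mathfrak U_1)$ for every $x\in(0,1)$ there exists $g\in\Gamma$ such that $g(x)<x$; $(\mathfrak U_2)$ for every $x\in(0,1)$ there exists $g\in\Gamma$ such that $g(x)>x$. If $g((0,1))\subset(0,1)$ for every $g\in\Gamma$ and there exist $g_0,g_1\in\Gamma$ with $g_0(0)\in(0,1)$ and $g_1(1)\in(0,1)$, then $(\Gamma,\mu)$ is uniquely ergodic.
   Context: $C([0,1])$ denotes the space of all continuous functions $g:[0,1]\to[0,1]$ with the supremum metric. A stochastic dynamical system on $C([0,1])$ is a pair $(\Gamma,\mu)$ where $\mu$ is a Borel probability measure on $C([0,1])$ and $\Gamma=\operatorname{supp}(\mu)$ is its topological support. Products of functions denote composition: $g_1g_2\cdots g_n=g_1\circ g_2\circ\cdots\circ g_n$. $\bigvee_a^b g$ denotes the total variation of $g$ on $[a,b]$, i.e. the supremum of $\sum_{i=1}^n|g(x_i)-g(x_{i-1})|$ over all partitions $a=x_0<x_1<\cdots<x_n=b$ (possibly $+\infty$). A Borel probability measure $\nu$ on $[0,1]$ is $\mu$-invariant ($=\mu$-stationary) if $\nu(A)=\int_\Gamma \nu(g^{-1}(A))\,d\mu(g)$ for every Borel set $A\subset[0,1]$. $(\Gamma,\mu)$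 is uniquely ergodic if there is exactly one $\mu$-invariant Borel probability measure on $[0,1]$. *)

(* Defs.v *)
From HB Require Import structures.
From mathcomp Require Import all_boot all_order all_algebra.
From mathcomp Require Import all_classical all_reals all_analysis.

Set Implicit Arguments.
Unset Strict Implicit.
Unset Printing Implicit Defensive.

Import Order.TTheory GRing.Theory Num.Theory.
Import numFieldNormedType.Exports.

Local Open Scope classical_set_scope.
Local Open Scope ring_scope.

Definition I01 (R : realType) : Type := set_type [set` `[0%R : R, 1%R]].

HB.instance Definition _ (R : realType) := SubType.on (I01 R).
HB.instance Definition _ (R : realType) :=
  PseudoMetric.copy (I01 R) (set_type [set` `[0%R : R, 1%R]]).

Section unit_interval.
Context {R : realType}.

Lemma i0_subproof : (0 : R) \in [set` `[0%R : R, 1%R]].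
Proof. by rewrite inE /= in_itv /= lexx ler01. Qed.

Lemma i1_subproof : (1 : R) \in [set` `[0%R : R, 1%R]].
Proof. by rewrite inE /= in_itv /= lexx ler01. Qed.

Definition i0 : I01 R := exist _ 0 i0_subproof.
Definition i1 : I01 R := exist _ 1 i1_subproof.

HB.instance Definition _ := isPointed.Build (I01 R) i0.

Lemma I01_itv (x : I01 R) : 0 <= \val x <= 1.
Proof. by case: x => x /=; rewrite inE /= in_itv. Qed.

End unit_interval.

Definition C01 (R : realType) : Type := continuousType (I01 R) (I01 R).

HB.instance Definition _ (R : realType) := Choice.on (C01 R).

Section sup_metric.
Context {R : realType}.
Implicit Types f g h : C01 R.

Definition sup_dist f g : R :=
  sup (range (fun x => `|\val (f x) - \val (g x)|)).

Let dist_has_sup f g : has_sup (range (fun x => `|\val (f x) - \val (g x)|)).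
Proof.
split; first by exists `|\val (f i0) - \val (g i0)|, i0.
exists 1 => _ [x _ <-].
have /andP[a0 a1] := I01_itv (f x); have /andP[b0 b1] := I01_itv (g x).
rewrite ler_norml; apply/andP; split.
  by rewrite lerBrDr (le_trans _ a0)// addrC subr_le0.
by rewrite lerBlDr (le_trans a1)// lerDl.
Qed.

Let dist_le f g x : `|\val (f x) - \val (g x)| <= sup_dist f g.
Proof. by apply: sup_upper_bound; [exact: dist_has_sup|exists x]. Qed.

Let le_dist f g (c : R) :
  (forall x, `|\val (f x) - \val (g x)| <= c) -> sup_dist f g <= c.
Proof.
move=> h; apply: ge_sup; first by case: (dist_has_sup f g).
by move=> _ [x _ <-].
Qed.

Let sup_distxx f : sup_dist f f = 0.
Proof.
apply/eqP; rewrite eq_le; apply/andP; split.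
  by apply: le_dist => x; rewrite subrr normr0.
by apply: le_trans (dist_le f f i0).
Qed.

Let sup_dist_positivity f g : sup_dist f g = 0 -> f = g.
Proof.
move=> fg0; apply/continuousEP => x; apply/val_inj/eqP.
by rewrite -subr_eq0 -normr_le0 (le_trans (dist_le f g x))// fg0.
Qed.

Let sup_dist_sym f g : sup_dist f g = sup_dist g f.
Proof.
by apply/eqP; rewrite eq_le; apply/andP; split; apply: le_dist => x;
  rewrite distrC; exact: dist_le.
Qed.

Let sup_dist_triangle g f h : sup_dist f h <= sup_dist f g + sup_dist g h.
Proof.
apply: le_dist => x; apply: le_trans (ler_distD (\val (g x)) _ _) _.
by apply: lerD; exact: dist_le.
Qed.

HB.instance Definition _ := @isMetric.Build R (C01 R) sup_dist
  sup_distxx sup_dist_positivity sup_dist_sym sup_dist_triangle.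

Definition C01_id : C01 R := idfun.
HB.instance Definition _ := isPointed.Build (C01 R) C01_id.

End sup_metric.

Notation borel T := (g_sigma_algebraType (@open T)).

Definition cylinders (d : measure_display) (T : measurableType d) :
    set (set (nat -> T)) :=
  \bigcup_i preimage_set_system setT (fun w : nat -> T => w i) measurable.

Notation product_space T := (g_sigma_algebraType (@cylinders _ T)).

(* The library has no infinite product measures.  The power of [mu] indexed by
   [nat] is the unique probability on the product sigma-algebra with the
   following values on measurable rectangles (existence: Ionescu-Tulcea;
   uniqueness: rectangles are a generating pi-system). *)
Definition is_power_measure (d : measure_display) (T : measurableType d)
    (R : realType) (mu : probability T R)
    (P : probability (product_space T) R) : Prop :=
  forall (n : nat) (B : nat -> set T), (forall i, measurable (B i)) ->
    P [set w | forall i, (i < n)%N -> B i (w i)] =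
    (\prod_(i < n) mu (B i))%E.

Definition msupport (R : realType) (T : ptopologicalType)
    (mu : probability (borel T) R) : set T :=
  [set x | forall U : set T, open U -> U x -> (0 < mu U)%E].

Section random_dynamics.
Context {R : realType}.

(* [total_variation] is about functions on the whole line, but it only looks
   at partitions of the given segment: the value 0 outside is irrelevant. *)
Definition extend01 (f : I01 R -> I01 R) : R -> R :=
  'valL_0 (fun x => \val (f x)).

Lemma extend01E (f : I01 R -> I01 R) (x : I01 R) :
  extend01 f (\val x) = \val (f x).
Proof.
exact: (congr1 (@^~ x)
  (valLK 0 (A := [set` `[0%R : R, 1%R]]) (fun y : I01 R => \val (f y)))).
Qed.

Definition TV01 (f : I01 R -> I01 R) : \bar R :=
  total_variation 0 1 (extend01 f).

(* Sequences are indexed from 0: [prefix_comp g n] is the composition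
   g_0 \o ... \o g_(n-1), in which g_(n-1) is applied first. *)
Definition prefix_comp (g : nat -> C01 R) (n : nat) : I01 R -> I01 R :=
  \big[comp/idfun]_(i < n) (g i : I01 R -> I01 R).

Definition bounded_prefix_TV (mu : probability (borel (C01 R)) R) :
    set (nat -> C01 R) :=
  [set g | (forall i, msupport mu (g i)) /\
           (ereal_sup [set TV01 (prefix_comp g n) | n in [set n | (0 < n)%N]]
              < +oo)%E].

Definition stationary (mu : probability (borel (C01 R)) R)
    (nu : probability (borel (I01 R)) R) : Prop :=
  forall A : set (I01 R), open.-sigma.-measurable A ->
    nu A = (\int[mu]_(g in msupport mu) nu ((g : C01 R) @^-1` A))%E.

(* Measures are total set functions in the library, so uniqueness can only be
   asked for on the Borel sets. *)
Definition uniquely_ergodic (mu : probability (borel (C01 R)) R) : Prop :=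
  exists2 nu : probability (borel (I01 R)) R, stationary mu nu &
    forall nu' : probability (borel (I01 R)) R, stationary mu nu' ->
      forall A : set (I01 R), open.-sigma.-measurable A -> nu' A = nu A.

End random_dynamics.

(* Main.v *)
From HB Require Import structures.
Require Import Defs.
From mathcomp Require Import all_boot all_order all_algebra.
From mathcomp Require Import all_classical all_reals all_analysis.
From mathcomp Require Import measurable_realfun.
From mathcomp Require Import ring lra.

Set Implicit Arguments.
Unset Strict Implicit.
Unset Printing Implicit Defensive.

Import Order.TTheory GRing.Theory Num.Theory.
Import numFieldNormedType.Exports.

Local Open Scope classical_set_scope.
Local Open Scope ring_scope.

(** Idea.  Let U f (x) = E f(g x) be the transfer operator and A_N its Cesaro
    means.  We show that the oscillation of A_N f on [0,1] tends to 0 for every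
    continuous f; existence and uniqueness of the stationary measure follow.

    Maximum principle: by (U1) and the hypotheses on the end points, from every
    point of [0,1] the chain enters each interval (0,a) with positive
    probability.  Since U^j A_N f is close to A_N f for large N, the function
    A_N f nearly attains both its maximum and its minimum in (b,a), where b > 0
    depends on a only; iterating, it does so alternately at arbitrarily many
    interlaced points.  So if A_N f is uniformly eps-close to functions of
    variation bounded independently of N, its oscillation is eventually about
    eps.

    Let B_n be the event that the compositions g_1...g_j, 1 <= j <= n, have
    variation at most K, with K such that p = inf P(B_n) > 0, and choose n with
    P(B_n) - inf P(B_k) <= eps.  Then psi = E[1_{B_n} f(g_1...g_n x)] satisfies
    |U^k psi - E[1_{B_(n+k)} f(g_1...g_(n+k) x)]| <= eps, and the latter
    function has controlled variation.  As U^n f - psi takes values in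
    [0, 1 - p], the supremum s of the limiting oscillations over all f with
    values in [0,1] satisfies s <= (1 - p) s + O(eps), so s = 0. *)

(** * Bounded functions *)

(** Variation is bounded on an event of positive probability only, so [U^n f] itself has no
    variation bound, and conditioning on the event would destroy the Markov structure. What helps is
    the order of composition: in [g_1...g_n] the newest map is applied first, so [U] acts on
    [E[1_S f(g_1...g_n x)]] by inserting [g_(n+1)] innermost, and an event [S] about the first [n]
    maps is carried along unchanged. Freezing [B_n] while the orbit grows costs at most
    [P(B_n) - P(B_(n+k))], whence the choice of [n]. The remainder is the same expectation over the
    complement of [B_n]; nothing is known about its variation, so after rescaling to [0,1] it is fed
    back into the estimate being proved. In the maximum principle, uniformity in [N] comes from
    compactness of [0,1]. With [m] interlaced pairs a variation bound [K] costs [K / m] per pair, so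
    its size is irrelevant once it is independent of [N]. *)

Section bounded_functions.
Context {R : realType}.

Definition bounded_continuous (f : R -> R) :=
  continuous f /\ exists M, forall x, `|f x| <= M.

Context d (T : measurableType d) (m : probability T R).

Lemma bounded_integrable (D : set T) (f : T -> R) (M : R) : measurable D ->
  measurable_fun setT f -> (forall x, `|f x| <= M) ->
  m.-integrable D (EFin \o f).
Proof.
move=> mD mf fM; apply: measurable_bounded_integrable => //.
- by rewrite (le_lt_trans (probability_le1 m mD))// ltry.
- exact: measurable_funTS.
- exists M; split; first exact: num_real.
  by move=> x Mx y _ /=; rewrite (le_trans (fM y))// ltW.
Qed.

Lemma continuous_Rintegral (D : set T) (F : R -> T -> R) (M : R) :
  measurable D -> (forall x, measurable_fun setT (F x)) ->
  (forall y, continuous (F ^~ y)) -> (forall x y, `|F x y| <= M) ->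
  continuous (fun x => \int[m]_(y in D) F x y).
Proof.
move=> mD mF cF FM x.
(* Dominated convergence is applied on an open interval of parameters; continuity is local, so any
   interval around [x] will do. *)
have xI : x \in `]x - 1, x + 1[%R by rewrite in_itv/=; lra.
apply: (@continuity_under_integral R d T m F D mD (x - 1) (x + 1) _ _ (cst M)).
- by move=> z _; exact: (bounded_integrable mD (mF z) (FM z)).
- by apply: aeW => y _ z _; exact: cF.
- by apply: (@bounded_integrable _ _ `|M|) => //; exact: measurable_cst.
- by move=> z _; apply: aeW => y _; exact: FM.
- by rewrite inE.
Qed.

Lemma le_bounded_Rintegral (D : set T) (f g : T -> R) (M : R) : measurable D ->
  measurable_fun setT f -> measurable_fun setT g ->
  (forall x, `|f x| <= M) -> (forall x, `|g x| <= M) ->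
  (forall x, D x -> f x <= g x) ->
  \int[m]_(x in D) f x <= \int[m]_(x in D) g x.
Proof.
by move=> mD mf mg fM gM fg; apply: le_Rintegral => //; exact: bounded_integrable.
Qed.

Lemma Rintegral_bounds (D : set T) (f : T -> R) (a b : R) : measurable D ->
  measurable_fun setT f -> (forall x, a <= f x <= b) ->
  a * fine (m D) <= \int[m]_(x in D) f x <= b * fine (m D).
Proof.
move=> mD mf fab.
have fM x : `|f x| <= `|a| + `|b|.
  have /andP[] := fab x; rewrite ler_norml => ax bx.
  have := ler_norm b; have := ler_norm (- a); rewrite normrN.
  have := normr_ge0 a; have := normr_ge0 b; lra.
have M0 (c : R) : `|c| <= `|a| + `|b| -> forall x : T, `|cst c x| <= `|a| + `|b| by [].
rewrite -!(Rintegral_cst m mD); apply/andP; split;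
  apply: (@le_bounded_Rintegral _ _ _ (`|a| + `|b|)) => //.
- by move=> x /=; rewrite lerDl.
- by move=> x _; case/andP: (fab x).
- by move=> x /=; rewrite lerDr.
- by move=> x _; case/andP: (fab x).
Qed.

End bounded_functions.

(** * The product space *)

Section grid.
Context {R : realType}.

Definition grid (n : nat) (x : R) : R :=
  (Num.floor (n.+1%:R * x))%:~R / n.+1%:R.

Lemma grid_itv n x : x - n.+1%:R^-1 < grid n x <= x.
Proof.
have n0 : 0 < n.+1%:R :> R by rewrite ltr0n.
have /andP[fl fu] := floor_itv (n.+1%:R * x).
rewrite /grid ler_pdivrMr// (mulrC x) fl andbT ltr_pdivlMr// mulrBl.
by rewrite mulVf ?gt_eqF// ltrBlDr (mulrC x) (lt_le_trans fu)// intrD.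
Qed.

Lemma cvg_grid x : grid n x @[n --> \oo] --> x.
Proof.
apply: (@squeeze_cvgr _ _ _ _ (fun n => x - harmonic n) (fun=> x)).
- by near=> n; have /andP[/ltW ? ?] := grid_itv n x; exact/andP.
- rewrite -[X in _ --> X]subr0; apply: cvgB; first exact: cvg_cst.
  exact: cvg_harmonic.
- exact: cvg_cst.
Unshelve. all: by end_near. Qed.

(* Continuity in the second variable reduces joint measurability to the values
   of [e] on the countable grids. *)
Lemma measurable_eval d1 d2 (W : measurableType d1) (T : measurableType d2)
    (e : T -> R -> R) (G : W -> T) (f : W -> R) :
  (forall g, continuous (e g)) -> (forall x, measurable_fun setT (e ^~ x)) ->
  measurable_fun setT G -> measurable_fun setT f ->
  measurable_fun setT (fun w => e (G w) (f w)).
Proof.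
move=> ce me mG mf.
apply: (@measurable_fun_cvg _ _ _ _ (fun n w => e (G w) (grid n (f w)))).
  move=> n _ Y mY; rewrite setTI.
  have -> : (fun w => e (G w) (grid n (f w))) @^-1` Y =
      \bigcup_(k : int) ([set w | k%:~R <= n.+1%:R * f w < (k + 1)%:~R] `&`
        [set w | Y (e (G w) (k%:~R / n.+1%:R))]).
    apply/seteqP; split => [w /= Yw|w [k _ /= [/floor_def <-]]]//.
    by exists (Num.floor (n.+1%:R * f w)) => //; split => //=; exact: floor_itv.
  apply: countable_bigcupT_measurable => // k; apply: measurableI.
    have /(_ measurableT `[k%:~R, (k + 1)%:~R[%classic) :
        measurable_fun setT (fun w => n.+1%:R * f w).
      by apply: measurable_funM => //; exact: measurable_cst.
    rewrite setTI (_ : _ @^-1` _ = [set w | k%:~R <= n.+1%:R * f w < (k + 1)%:~R]).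
      by apply; exact: measurable_itv.
    by apply/seteqP; split => w /=; rewrite in_itv.
  have /(_ measurableT Y mY) := measurableT_comp (me (k%:~R / n.+1%:R)) mG.
  by rewrite setTI.
move=> w _; apply: (@cvg_comp _ _ _ (fun n => grid n (f w)) (e (G w))).
  exact: cvg_grid.
exact: ce.
Qed.

End grid.

(** * Image laws and Fubini's theorem for bounded functions *)

Section law.
Context d1 d2 (T1 : measurableType d1) (T2 : measurableType d2) {R : realType}.

Definition law (m : probability T1 R) (f : T1 -> T2)
    (mf : measurable_fun setT f) : probability T2 R :=
  distribution m (HB.pack f (isMeasurableFun.Build _ _ _ _ _ mf) :
    {mfun T1 >-> T2}).

Lemma lawE (m : probability T1 R) (f : T1 -> T2) (mf : measurable_fun setT f) A :
  law m mf A = m (f @^-1` A).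
Proof. by []. Qed.

Lemma Rintegral_law (m : probability T1 R) (f : T1 -> T2)
    (mf : measurable_fun setT f) (h : T2 -> R) (M : R) :
  measurable_fun setT h -> (forall x, `|h x| <= M) ->
  \int[law m mf]_x h x = \int[m]_x h (f x).
Proof.
move=> mh hM; rewrite /Rintegral; congr fine.
rewrite integral_pushforward//; first exact/measurable_EFinP.
rewrite preimage_setT; apply: (@bounded_integrable _ _ _ m _ (h \o f) M) => //.
  exact: measurableT_comp.
by move=> x; exact: hM.
Qed.

Lemma eq_measure_Rintegral (m1 m2 : probability T1 R) (h : T1 -> R) :
  (forall A, measurable A -> m1 A = m2 A) ->
  \int[m1]_x h x = \int[m2]_x h x.
Proof.
by move=> m12; congr fine; apply: eq_measure_integral => A mA _; exact: m12.
Qed.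

Lemma bounded_Fubini (m1 : probability T1 R) (m2 : probability T2 R)
    (f : T1 * T2 -> R) (M : R) :
  measurable_fun setT f -> (forall x, `|f x| <= M) ->
  \int[(m1 \x m2)%E]_z f z = \int[m1]_x \int[m2]_y f (x, y) /\
  \int[(m1 \x m2)%E]_z f z = \int[m2]_y \int[m1]_x f (x, y).
Proof.
move=> mf fM.
have if_ : (m1 \x m2)%E.-integrable setT (EFin \o f).
  exact: (@bounded_integrable _ _ _ (m1 \x m2)%E _ _ M).
split; rewrite {1}/Rintegral.
  rewrite -integral12_prod_meas1//; congr fine; apply: eq_integral => x _.
  rewrite /Rintegral fineK//; apply: integrable_fin_num => //.
  apply: (@bounded_integrable _ _ _ m2 _ (fun y => f (x, y)) M) => //.
  exact: measurable_fun_pair2.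
rewrite -integral21_prod_meas1//; congr fine; apply: eq_integral => y _.
rewrite /Rintegral fineK//; apply: integrable_fin_num => //.
apply: (@bounded_integrable _ _ _ m1 _ (fun x => f (x, y)) M) => //.
exact: measurable_fun_pair1.
Qed.

End law.

(** * The power measure and the independence of its coordinates *)

Section product_space.
Context {d} {T : measurableType d} {R : realType}.

Let rect n (B : nat -> set T) :=
  [set w : nat -> T | forall i, (i < n)%N -> B i (w i)].

Lemma measurable_coordinate i :
  measurable_fun setT ((fun w => w i) : product_space T -> T).
Proof.
move=> _ A mA; rewrite setTI; apply: sub_sigma_algebra.
by exists i => //; exists A => //; rewrite setTI.
Qed.

Lemma measurable_rectangle n (B : nat -> set T) :
  (forall i, measurable (B i)) -> measurable (rect n B : set (product_space T)).
Proof.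
move=> mB; rewrite (_ : rect n B =
    \bigcap_i (fun w => w i) @^-1` (if (i < n)%N then B i else setT)).
  apply: bigcapT_measurable => i; rewrite -[X in measurable X]setTI.
  by apply: measurable_coordinate => //; case: ifP.
apply/seteqP; split => w /= h i; first by move=> _ /=; case: ifP => // /h.
by move=> ilt; have /= := h i I; rewrite ilt.
Qed.

(** Rectangles form a generating pi-system, so Dynkin's theorem applies. *)
Lemma eq_rectangle_measure (P Q : probability (product_space T) R) :
  (forall n B, (forall i, measurable (B i)) -> P (rect n B) = Q (rect n B)) ->
  forall A, measurable A -> P A = Q A.
Proof.
move=> PQ.
pose G : set (set (product_space T)) :=
  [set A | exists n B, (forall i, measurable (B i)) /\ A = rect n B].
apply: (@measure_unique _ _ _ G (fun=> setT)) => //.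
- apply/seteqP; split; apply: smallest_sub.
  + exact: smallest_sigma_algebra.
  + move=> A [i _ [B mB <-]]; rewrite setTI; apply: sub_sigma_algebra.
    (* A cylinder over coordinate [i] is a rectangle of length [i.+1] whose other sides are full. *)
    exists i.+1, (fun j => if j == i then B else setT); split.
      by move=> j; case: ifP.
    apply/seteqP; split => w /= h.
      by move=> j _; case: eqP => // ->.
    by have := h i (ltnSn i); rewrite eqxx.
  + exact: smallest_sigma_algebra.
  + by move=> _ [n [B [mB ->]]]; exact: measurable_rectangle.
- move=> _ _ [n [B [mB ->]]] [m [C [mC ->]]].
  (* Filling the missing sides with [setT] brings both rectangles to a common length. *)
  exists (maxn n m), (fun i => (if (i < n)%N then B i else setT) `&`
     (if (i < m)%N then C i else setT)); split.
    by move=> i; apply: measurableI; case: ifP.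
  apply/seteqP; split => w /=.
    by move=> [hB hC] i _; split; case: ifP => // ?; [exact: hB|exact: hC].
  move=> h; split => i ilt.
    by have [] := h i (leq_trans ilt (leq_maxl _ _)); rewrite ilt.
  by have [] := h i (leq_trans ilt (leq_maxr _ _)); rewrite ilt.
- by move=> _; exists 0%N, (fun=> setT); split => //; apply/seteqP; split.
- by rewrite bigcup_const.
- by move=> _ [n [B [mB ->]]]; exact: PQ.
- by move=> _; rewrite (le_lt_trans (probability_le1 P measurableT))// ltry.
Qed.

Definition update (w : nat -> T) k g i := if i == k then g else w i.

Lemma measurable_update k : measurable_fun setT
  ((fun z => update z.1 k z.2) : product_space T * T -> product_space T).
Proof.
apply: (@measurability _ _ (product_space T * T)%type (product_space T) setT _
  (@cylinders _ T)) => //.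
move=> _ [_ [i _ [B mB <-]] <-]; rewrite !setTI /update.
rewrite (_ : _ @^-1` _ = (fun z : product_space T * T =>
   if i == k then z.2 else z.1 i) @^-1` B)//.
rewrite -[X in measurable X]setTI; case: (i == k); first exact: measurable_snd.
exact: (measurableT_comp (measurable_coordinate i) measurable_fst).
Qed.

Variables (mu : probability T R) (P : probability (product_space T) R).
Hypothesis hP : is_power_measure mu P.

(** On a rectangle longer than [k], the side at [k] splits off as the factor [mu (B k)]; a shorter
    one does not see the resampling. *)
Lemma power_measure_update k (A : set (product_space T)) : measurable A ->
  P A = law (P \x mu)%E (measurable_update k) A.
Proof.
apply: eq_rectangle_measure => n B mB.
have hPr m C : (forall i, measurable (C i)) ->
  P (rect m C) = (\prod_(i < m) mu (C i))%E by exact: hP.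
transitivity (\prod_(i < n) mu (B i))%E; first exact: hP.
rewrite lawE; have [kn|nk] := ltnP k n.
  rewrite (_ : _ @^-1` _ = rect n (fun i => if i == k then setT else B i) `*` B k).
    have mB' i : measurable (if i == k then setT else B i) by case: ifP.
    apply/esym; etransitivity.
      apply: product_measure1E => //; exact: measurable_rectangle.
    apply/esym; transitivity ((\prod_(i < n)
      mu (if (i : nat) == k then setT else B i)) * mu (B k))%E;
      last by congr (_ * _)%E; exact/esym/hPr.
    rewrite (bigD1 (Ordinal kn))//= muleC; congr (_ * _)%E.
    rewrite [in RHS](bigD1 (Ordinal kn))//= eqxx probability_setT mul1e.
    by apply: eq_bigr => i; rewrite -val_eqE/= => /negbTE ->.
  rewrite /update; apply/seteqP; split => -[w g] /=.
    move=> h; split; last by have := h k kn; rewrite eqxx.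
    by move=> i /h; case: eqP.
  by move=> [h gB] i /h; case: eqP => // ->.
rewrite (_ : _ @^-1` _ = rect n B `*` setT).
  apply/esym; etransitivity.
    apply: product_measure1E => //; exact: measurable_rectangle.
  rewrite [X in (_ * X)%E](_ : _ = 1%E); last exact: probability_setT.
  by rewrite mule1; exact: hPr.
rewrite /update; apply/seteqP; split => -[w g] /=.
  move=> h; split => // i ilt; have := h i ilt; case: eqP => // ik.
  by move: ilt; rewrite ik ltnNge nk.
move=> [h _] i ilt; case: eqP => [ik|_]; last exact: h.
by move: ilt; rewrite ik ltnNge nk.
Qed.

(* Resampling one coordinate: this is all the independence that is used. *)
Lemma Rintegral_update k (F : (nat -> T) -> R) (M : R) :
  measurable_fun setT (F : product_space T -> R) -> (forall x, `|F x| <= M) ->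
  \int[P]_w F w = \int[mu]_g \int[P]_w F (update w k g).
Proof.
move=> mF FM; rewrite (eq_measure_Rintegral _ (power_measure_update k)).
rewrite (Rintegral_law _ _ mF FM).
have [_ ->//] := @bounded_Fubini _ _ _ _ _ P mu (fun z => F (update z.1 k z.2)) M
  (measurableT_comp mF (measurable_update k)) (fun z => FM _).
Qed.

End product_space.

(** * The transfer operator *)

Section bounded_continuous.
Context {R : realType}.
Implicit Types f g : R -> R.

Lemma continuous_measurable f : continuous f -> measurable_fun setT f.
Proof. exact: continuous_measurable_fun. Qed.

Lemma bounded_continuous_cst (c : R) : bounded_continuous (fun=> c).
Proof. by split; [move=> x; exact: cvg_cst|exists `|c|]. Qed.

Lemma bounded_continuousD f g : bounded_continuous f -> bounded_continuous g ->
  bounded_continuous (fun x => f x + g x).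
Proof.
move=> [cf [M fM]] [cg [N gN]]; split.
  by move=> x; apply: cvgD; [exact: cf|exact: cg].
by exists (M + N) => x; rewrite (le_trans (ler_normD _ _))// lerD.
Qed.

Lemma bounded_continuousZ c f : bounded_continuous f ->
  bounded_continuous (fun x => c * f x).
Proof.
move=> [cf [M fM]]; split.
  by move=> x; apply: cvgM; [exact: cvg_cst|exact: cf].
by exists (`|c| * M) => x; rewrite normrM ler_wpM2l.
Qed.

Lemma bounded_continuousN f : bounded_continuous f ->
  bounded_continuous (fun x => - f x).
Proof.
by move=> /(bounded_continuousZ (-1)); under eq_fun do rewrite mulN1r.
Qed.

Lemma bounded_continuousB f g : bounded_continuous f -> bounded_continuous g ->
  bounded_continuous (fun x => f x - g x).
Proof. by move=> bf /bounded_continuousN; exact: bounded_continuousD. Qed.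

Lemma bounded_continuous_sum n (F : nat -> R -> R) :
  (forall i, bounded_continuous (F i)) ->
  bounded_continuous (fun x => \sum_(i < n) F i x).
Proof.
move=> bF; elim: n => [|n IH].
  by under eq_fun do rewrite big_ord0; exact: bounded_continuous_cst.
by under eq_fun do rewrite big_ord_recr/=; exact: bounded_continuousD.
Qed.

End bounded_continuous.

Section transfer_operator.
Context {R : realType} d (T : measurableType d).
Context (e : T -> R -> R) (ce : forall g, continuous (e g))
  (me : forall x, measurable_fun setT (e ^~ x)).
Implicit Types f h : R -> R.

(** The recursion adds the new map innermost, because that is where [transfer] inserts it. *)
Fixpoint orbit (w : nat -> T) n x :=
  if n is n'.+1 then orbit w n' (e (w n') x) else x.

Lemma continuous_orbit w n : continuous (orbit w n).
Proof.
elim: n => [|n IH] x /=; first exact: cvg_id.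
by apply: (@continuous_comp _ _ _ (e (w n)) (orbit w n)); [exact: ce|exact: IH].
Qed.

(** The starting point may depend on [w], since the induction replaces it by [e (w n) (u w)]. *)
Lemma measurable_orbit n (u : product_space T -> R) : measurable_fun setT u ->
  measurable_fun setT (fun w : product_space T => orbit w n (u w)).
Proof.
elim: n u => [//|n IH] u mu_ /=; apply: (IH (fun w => e (w n) (u w))).
exact: measurable_eval ce me (measurable_coordinate n) mu_.
Qed.

Lemma orbit_update w k g n x : (n <= k)%N -> orbit (update w k g) n x = orbit w n x.
Proof.
elim: n x => [//|n IH] x nk /=; rewrite IH ?(ltnW nk)//; congr orbit.
by rewrite /update (ltn_eqF nk).
Qed.

Context (mu : probability T R) (P : probability (product_space T) R)
  (hP : is_power_measure mu P).

(* [transfer], [partial_mean S n] and [orbit w n] are U, E[1_S f(g_1...g_n x)]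
   and g_1...g_n, the maps being written as functions on the line. *)
Definition transfer f x := \int[mu]_g f (e g x).

Definition partial_mean (S : set (nat -> T)) n f x :=
  \int[P]_(w in S) f (orbit w n x).

Lemma measurable_comp_e f x : continuous f -> measurable_fun setT (fun g => f (e g x)).
Proof. by move=> /continuous_measurable cf; exact: (measurableT_comp cf (me x)). Qed.

Lemma measurable_comp_orbit f n x : continuous f ->
  measurable_fun setT (fun w : product_space T => f (orbit w n x)).
Proof.
move=> /continuous_measurable cf; apply: (measurableT_comp cf).
by apply: measurable_orbit; exact: measurable_cst.
Qed.

Lemma transfer_bounded_continuous f :
  bounded_continuous f -> bounded_continuous (transfer f).
Proof.
move=> [cf [M fM]]; split.
  apply: (@continuous_Rintegral _ _ _ mu setT (fun x g => f (e g x)) M) => //.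
    by move=> x; exact: measurable_comp_e.
  by move=> g x; apply: (@continuous_comp _ _ _ (e g) f); [exact: ce|exact: cf].
exists M => x; rewrite ler_norml.
have := @Rintegral_bounds _ _ _ mu setT (fun g => f (e g x)) (- M) M measurableT
  (measurable_comp_e x cf).
rewrite probability_setT/= !mulr1; apply => g; have := fM (e g x).
by rewrite ler_norml.
Qed.

Lemma partial_mean_bounded_continuous (S : set (product_space T)) n f :
  measurable S -> bounded_continuous f -> bounded_continuous (partial_mean S n f).
Proof.
move=> mS [cf [M fM]]; split.
  apply: (@continuous_Rintegral _ _ _ P S (fun x w => f (orbit w n x)) M) => //.
    by move=> x; exact: measurable_comp_orbit.
  move=> w x; apply: (@continuous_comp _ _ _ (orbit w n) f); last exact: cf.
  exact: continuous_orbit.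
exists (`|M| * fine (P S)) => x.
rewrite ler_norml -mulNr.
apply: (@Rintegral_bounds _ _ _ P S (fun w => f (orbit w n x))) => //.
  exact: measurable_comp_orbit.
by move=> w; rewrite -ler_norml (le_trans (fM _))// ler_norm.
Qed.

Lemma transfer_bounds f a b x : bounded_continuous f ->
  (forall g, a <= f (e g x) <= b) -> a <= transfer f x <= b.
Proof.
move=> [cf _] fab.
have := @Rintegral_bounds _ _ _ mu setT (fun g => f (e g x)) a b measurableT
  (measurable_comp_e x cf) fab.
by rewrite probability_setT/= !mulr1.
Qed.

Let transfer_integrable f x : bounded_continuous f ->
  mu.-integrable setT (EFin \o (fun g => f (e g x))).
Proof.
move=> [cf [M fM]]; apply: (@bounded_integrable _ _ _ mu setT _ M) => //.
exact: measurable_comp_e.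
Qed.

Lemma transferD f h : bounded_continuous f -> bounded_continuous h ->
  transfer (fun x => f x + h x) = (fun x => transfer f x + transfer h x).
Proof.
move=> bf bh; apply/funext => x.
by apply: (RintegralD measurableT); exact: transfer_integrable.
Qed.

Lemma transferZ c f : bounded_continuous f ->
  transfer (fun x => c * f x) = (fun x => c * transfer f x).
Proof.
move=> bf; apply/funext => x.
by apply: (RintegralZl _ measurableT); exact: transfer_integrable.
Qed.

(** The map at coordinate [n] is applied first in [orbit w n.+1], and [S] ignores that coordinate;
    resampling it on the right-hand side produces the outer integral over [mu] on the left. *)
Lemma transfer_partial_mean (S : set (product_space T)) n f : measurable S ->
  (forall w g, S (update w n g) <-> S w) -> bounded_continuous f ->
  transfer (partial_mean S n f) = partial_mean S n.+1 f.
Proof.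
move=> mS hS [cf [M fM]]; apply/funext => x; rewrite /transfer /partial_mean/=.
(* The integral over [S] becomes that of a restricted function on the whole space, the form that
   [Rintegral_update] expects. *)
rewrite [RHS]Rintegral_mkcond.
have M0 : 0 <= M by exact: le_trans (fM 0).
rewrite (Rintegral_update hP n (M := M)).
- apply: eq_Rintegral => g _; rewrite [LHS]Rintegral_mkcond.
  apply: eq_Rintegral => w _; rewrite /patch.
  have -> : (update w n g \in S) = (w \in S).
    by apply/idP/idP => /set_mem/hS/mem_set.
  by rewrite orbit_update// /update eqxx.
- apply: (measurable_restrictT _ mS).1; apply: measurable_funTS.
  exact: (@measurable_comp_orbit f n.+1 x).
- by move=> w; rewrite /patch; case: ifP => _ //; rewrite normr0.
Qed.

Lemma partial_mean0 f : partial_mean setT 0 f = f.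
Proof.
apply/funext => x; rewrite /partial_mean/= (@Rintegral_cst _ _ _ P setT measurableT).
by rewrite [X in fine X](_ : _ = 1%E) ?mulr1//; exact: probability_setT.
Qed.

Lemma iter_transfer n f : bounded_continuous f ->
  iter n transfer f = partial_mean setT n f.
Proof.
move=> bf; elim: n => [|n IH] /=; first by rewrite partial_mean0.
by rewrite IH transfer_partial_mean.
Qed.

End transfer_operator.

(** * Markov operators and Cesaro means *)

(** Functions are defined on the whole line to avoid subtypes, while the dynamics takes place in
    [0,1]; this is where the quantitative bounds are stated. *)
Definition bounds01 {R : realType} (f : R -> R) a b :=
  forall x, 0 <= x <= 1 -> a <= f x <= b.

(** The maximum principle and the Cesaro arguments rest on these properties alone. Positivity and
    preservation of constants on [0,1] are both contained in [markov_bounds]. *)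
Record markov_operator {R : realType} (U : (R -> R) -> R -> R) : Prop := {
  markov_bc : forall f, bounded_continuous f -> bounded_continuous (U f) ;
  markovD : forall f h, bounded_continuous f -> bounded_continuous h ->
    U (fun x => f x + h x) = (fun x => U f x + U h x) ;
  markovZ : forall c f, bounded_continuous f ->
    U (fun x => c * f x) = (fun x => c * U f x) ;
  markov_bounds : forall f a b, bounded_continuous f -> bounds01 f a b ->
    bounds01 (U f) a b }.

Section markov_operator.
Context {R : realType} {U : (R -> R) -> R -> R} (mU : markov_operator U).
Implicit Types f h : R -> R.

Lemma iter_bc n f : bounded_continuous f -> bounded_continuous (iter n U f).
Proof. by move=> bf; elim: n => //= n; exact: (markov_bc mU). Qed.

Lemma iter_bounds n f a b : bounded_continuous f -> bounds01 f a b ->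
  bounds01 (iter n U f) a b.
Proof.
by move=> bf fab; elim: n => //= n; apply: (markov_bounds mU); exact: iter_bc.
Qed.

Lemma iter_opD n f h : bounded_continuous f -> bounded_continuous h ->
  iter n U (fun x => f x + h x) = (fun x => iter n U f x + iter n U h x).
Proof.
by move=> bf bh; elim: n => //= n ->; apply: (markovD mU); exact: iter_bc.
Qed.

Lemma iter_opZ n c f : bounded_continuous f ->
  iter n U (fun x => c * f x) = (fun x => c * iter n U f x).
Proof. by move=> bf; elim: n => //= n ->; apply: (markovZ mU); exact: iter_bc. Qed.

Lemma iter_cst n (c : R) x : 0 <= x <= 1 -> iter n U (fun=> c) x = c.
Proof.
move=> x01; apply/eqP; rewrite eq_le andbC.
apply: (@iter_bounds n (fun=> c) c c) => //; first exact: bounded_continuous_cst.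
by move=> z _; rewrite lexx.
Qed.

Lemma iter_sum j n (F : nat -> R -> R) : (forall i, bounded_continuous (F i)) ->
  (forall x, 0 <= x <= 1 -> 
   iter j U (fun x => \sum_(i < n) F i x) x = \sum_(i < n) iter j U (F i) x).
Proof.
move=> bF x x01; elim: n => [|n IH].
  by under eq_fun do rewrite big_ord0; rewrite iter_cst// big_ord0.
under eq_fun do rewrite big_ord_recr/=.
by rewrite iter_opD ?IH ?big_ord_recr//; exact: bounded_continuous_sum.
Qed.

Lemma le_iter n f h x : bounded_continuous f -> bounded_continuous h ->
  (forall y, 0 <= y <= 1 -> f y <= h y) -> 0 <= x <= 1 ->
  iter n U f x <= iter n U h x.
Proof.
move=> bf bh fh x01.
have [_ [M hM]] := bounded_continuousB bh bf.
have b01 : bounds01 (fun y => h y - f y) 0 M.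
  move=> y /fh; rewrite -subr_ge0 => -> /=.
  by rewrite (le_trans (ler_norm _) (hM y)).
have /andP[] := iter_bounds n (bounded_continuousB bh bf) b01 x01.
have -> : (fun y => h y - f y) = (fun y => h y + -1 * f y).
  by apply/funext => y; rewrite mulN1r.
rewrite iter_opD ?iter_opZ//; first by rewrite mulN1r subr_ge0.
exact: bounded_continuousZ.
Qed.

(** There are [N.+1] terms, so the divisor never vanishes. *)
Definition cesaro (V : (R -> R) -> R -> R) N f x :=
  N.+1%:R^-1 * \sum_(k < N.+1) iter k V f x.

Lemma cesaro_bc N f : bounded_continuous f -> bounded_continuous (cesaro U N f).
Proof.
move=> bf; apply: bounded_continuousZ.
by apply: (@bounded_continuous_sum _ _ (fun k => iter k U f)) => k; exact: iter_bc.
Qed.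

Lemma cesaroD N f h : bounded_continuous f -> bounded_continuous h ->
  cesaro U N (fun x => f x + h x) = (fun x => cesaro U N f x + cesaro U N h x).
Proof.
move=> bf bh; apply/funext => x; rewrite /cesaro -mulrDr -big_split/=.
by congr (_ * _); apply: eq_bigr => k _; rewrite iter_opD.
Qed.

Lemma cesaroZ N c f : bounded_continuous f ->
  cesaro U N (fun x => c * f x) = (fun x => c * cesaro U N f x).
Proof.
move=> bf; apply/funext => x; rewrite /cesaro [RHS]mulrCA; congr (_ * _).
by rewrite mulr_sumr; apply: eq_bigr => k _; rewrite iter_opZ.
Qed.

Lemma cesaro_bounds N f a b : bounded_continuous f -> bounds01 f a b ->
  bounds01 (cesaro U N f) a b.
Proof.
move=> bf fab x x01; rewrite /cesaro.
have N0 : 0 < N.+1%:R :> R by rewrite ltr0n.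
rewrite ler_pdivlMl// ler_pdivrMl//.
have cst_sum (c : R) : N.+1%:R * c = \sum_(k < N.+1) c.
  by rewrite sumr_const card_ord mulr_natl.
by rewrite !cst_sum; apply/andP; split; apply: ler_sum => k _;
  have /andP[] := iter_bounds k bf fab x01.
Qed.

Lemma cesaro_cst N (c : R) x : 0 <= x <= 1 -> cesaro U N (fun=> c) x = c.
Proof.
move=> x01; apply/eqP; rewrite eq_le andbC.
apply: (@cesaro_bounds N (fun=> c) c c) => //; first exact: bounded_continuous_cst.
by move=> z _; rewrite lexx.
Qed.

Lemma iter_cesaro j N f x : bounded_continuous f -> 0 <= x <= 1 ->
  iter j U (cesaro U N f) x = cesaro U N (iter j U f) x.
Proof.
move=> bf x01; rewrite /cesaro iter_opZ.
  rewrite (@iter_sum j N.+1 (fun k => iter k U f))//; last first.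
    by move=> i; exact: iter_bc.
  by congr (_ * _); apply: eq_bigr => k _; rewrite -!iterD addnC.
apply: (@bounded_continuous_sum _ _ (fun k => iter k U f)) => k; exact: iter_bc.
Qed.

(** The difference telescopes down to its end terms: this is the source of the almost invariance of
    Cesaro means. *)
Lemma cesaro_shift1 N f x :
  cesaro U N (U f) x - cesaro U N f x = N.+1%:R^-1 * (iter N.+1 U f x - f x).
Proof.
rewrite /cesaro -mulrBr -sumrB; congr (_ * _).
under eq_bigr do rewrite -iterSr.
rewrite -(big_mkord xpredT (fun k => iter k.+1 U f x - iter k U f x)).
by rewrite (telescope_sumr (fun k => iter k U f x)).
Qed.

Lemma cesaro_shift j N f x : bounded_continuous f -> bounds01 f 0 1 ->
  0 <= x <= 1 -> `|cesaro U N (iter j U f) x - cesaro U N f x| <= j%:R / N.+1%:R.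
Proof.
move=> bf f01 x01; elim: j => [|j IH]; first by rewrite subrr normr0 mul0r.
apply: le_trans (ler_distD (cesaro U N (iter j U f) x) _ _) _.
rewrite -[in leRHS](addn1 j) natrD mulrDl addrC lerD// mul1r iterS cesaro_shift1.
rewrite normrM gtr0_norm ?invr_gt0// ler_piMr ?invr_ge0// -iterD.
have /andP[] := iter_bounds (N.+1 + j) bf f01 x01.
have /andP[] := iter_bounds j bf f01 x01.
by rewrite ler_norml; lra.
Qed.

End markov_operator.

(** * The maximum principle *)

Section bump.
Context {R : realType}.

Lemma continuous_maxr (f g : R -> R) : continuous f -> continuous g ->
  continuous (fun x => Num.max (f x) (g x)).
Proof. by move=> cf cg x; exact: continuous_max (cf x) (cg x). Qed.

Lemma continuous_minr (f g : R -> R) : continuous f -> continuous g ->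
  continuous (fun x => Num.min (f x) (g x)).
Proof. by move=> cf cg x; exact: continuous_min (cf x) (cg x). Qed.

(** A tent over (0, a), lowered by [c] and cut off at 0. It is positive exactly on (c, a - c) and
    serves as a continuous substitute for the indicator of that interval. *)
Definition bump (a c x : R) := Num.max 0 (Num.min x (a - x) - c).

Let min_le (a x : R) : Num.min x (a - x) <= x /\ Num.min x (a - x) <= a - x.
Proof. by rewrite !ge_min !lexx orbT. Qed.

Lemma bump_bc a c : bounded_continuous (bump a c).
Proof.
split.
  have cm : continuous (fun x : R => Num.min x (a - x)).
    apply: continuous_minr => y; first exact: cvg_id.
    by apply: cvgB; [exact: cvg_cst|exact: cvg_id].
  apply: continuous_maxr => x; first exact: cvg_cst.
  by apply: cvgB; [exact: cm|exact: cvg_cst].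
exists (`|a| + `|c|) => x; rewrite ger0_norm; last by rewrite le_max lexx.
have a0 := normr_ge0 a; have c0 := normr_ge0 c.
have := ler_norm a; have := ler_norm (- c); rewrite normrN.
by have [] := min_le a x; rewrite /bump ge_max; lra.
Qed.

Lemma bump_ge0 a c x : 0 <= bump a c x.
Proof. by rewrite le_max lexx. Qed.

Lemma bump_le1 a c x : a <= 1 -> 0 <= c -> bump a c x <= 1.
Proof. by have [] := min_le a x; rewrite /bump ge_max; lra. Qed.

Lemma bump_gt0 a x : 0 < x < a -> 0 < bump a 0 x.
Proof. by move=> xa; rewrite lt_max; apply/orP; right; rewrite subr0 lt_min; lra. Qed.

Lemma bump_support a c x : 0 < bump a c x -> c < x < a - c.
Proof. by rewrite lt_max ltxx/= subr_gt0 lt_min; lra. Qed.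

Lemma bump_cut a c x : 0 <= c -> bump a 0 x <= bump a c x + c.
Proof.
move=> c0; rewrite /bump subr0 ge_max; apply/andP; split.
  by rewrite addr_ge0// le_max lexx.
by rewrite -lerBlDr le_max lexx orbT.
Qed.

End bump.

Section maximum_principle.
Context {R : realType} {U : (R -> R) -> R -> R} (mU : markov_operator U).
Implicit Types f h : R -> R.

(** In terms of test functions: [y] lies in the support of the one-step law started at [x]. *)
Definition accessible x y := forall f, bounded_continuous f ->
  (forall z, 0 <= z <= 1 -> 0 <= f z) -> 0 < f y -> 0 < U f x.

Context
  (acc : forall x, 0 < x < 1 -> exists2 y, 0 < y < 1 & y < x /\ accessible x y)
  (acc0 : exists2 y, 0 < y < 1 & accessible 0 y)
  (acc1 : exists2 y, 0 < y < 1 & accessible 1 y).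

Lemma iter_bump_ge0 j a c x : 0 <= x <= 1 -> 0 <= iter j U (bump a c) x.
Proof.
move=> x01; have [_ [M bM]] := bump_bc a c.
have bI : bounds01 (bump a c) 0 M.
  by move=> s _; rewrite bump_ge0 (le_trans (ler_norm _)).
by have /andP[] := iter_bounds mU j (bump_bc a c) bI x01.
Qed.

(** Let [s] be the supremum of the [t] such that every point of (0, t) reaches (0, a). If [s < 1],
    then [s] has access to some [y < s], so [s] reaches (0, a) too, and by continuity so do the
    points slightly beyond [s], a contradiction. The end points enter (0, 1) by [acc0] and
    [acc1]. *)
Lemma iter_bump_gt0 a x : 0 < a <= 1 -> 0 <= x <= 1 ->
  exists j, 0 < iter j U (bump a 0) x.
Proof.
move=> a01; pose D x := exists j, 0 < iter j U (bump a 0) x.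
have bb j := iter_bc mU j (@bump_bc _ a 0).
have Dacc z y : accessible z y -> D y -> D z.
  move=> zy [j jy]; exists j.+1; apply: zy (bb j) _ jy => t.
  exact: iter_bump_ge0.
pose E := [set t : R | 0 < t <= 1 /\ forall z, 0 < z < t -> D z].
have Ea : E a by split => // z za; exists 0%N; exact: bump_gt0.
have supE : has_sup E by split; [exists a|exists 1 => t [/andP[]]].
have as_ : a <= sup E by exact: sup_upper_bound.
have s1 : sup E <= 1 by apply: ge_sup; [exists a|move=> t [/andP[]]].
have Ds z : 0 < z < sup E -> D z.
  move=> /andP[z0 zs].
  have [t [_ tD] zt] : exists2 t, E t & z < t.
    have e0 : 0 < sup E - z by rewrite subr_gt0.
    by have [t Et st] := sup_adherent e0 supE; exists t => //; lra.
  by apply: tD; rewrite z0.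
have D01 z : 0 < z < 1 -> D z.
  suff -> : 1 = sup E by exact: Ds.
  apply/eqP; rewrite eq_le s1 andbT leNgt; apply/negP => s_lt1.
  have [y y01 [ys sy]] : exists2 y, 0 < y < 1 & y < sup E /\ accessible (sup E) y.
    by apply: acc; lra.
  have [j js] : D (sup E) by apply: Dacc sy _; apply: Ds; lra.
  have [cj _] := bb j.
  have /nbhs_ballP[r /= r0 rD] : \forall t \near sup E, 0 < iter j U (bump a 0) t.
    by apply: (cvgr_gt _ (cj (sup E))).
  have [t [ts t1 tr]] : exists t, [/\ sup E < t, t <= 1 & t < sup E + r].
    by exists (Num.min 1 (sup E + r / 2)); rewrite /Num.min; case: ifPn; split; lra.
  suff /(sup_upper_bound supE) : E t by lra.
  split; first lra.
  move=> u /andP[u0 ut]; have [us|su] := ltP u (sup E); first by apply: Ds; rewrite u0.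
  by exists j; apply: rD; rewrite /ball/= ltr_norml; lra.
move=> /andP[x0 x1].
have [->|xN0] := eqVneq x 0; first by case: acc0 => y /D01; move=> /[swap]/Dacc; exact.
have [->|xN1] := eqVneq x 1; first by case: acc1 => y /D01; move=> /[swap]/Dacc; exact.
by apply: D01; rewrite !lt_neqAle eq_sym xN0 x0 xN1.
Qed.

(** The number of steps needed depends on [x]. Summing over all [j < J] makes positivity monotone in
    [J], so that compactness yields one [J] for all points. *)
Lemma sum_iter_bump_gt0 a : 0 < a <= 1 ->
  exists J c, 0 < c /\ forall x, 0 <= x <= 1 ->
    c <= \sum_(j < J) iter j U (bump a 0) x.
Proof.
move=> a01.
pose S J x := \sum_(j < J) iter j U (bump a 0) x.
have bb j := iter_bc mU j (@bump_bc _ a 0).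
have cS J : continuous (S J).
  by have [] := @bounded_continuous_sum _ J (fun j => iter j U (bump a 0)) bb.
have ndS x : 0 <= x <= 1 -> forall m n, (m <= n)%N -> S m x <= S n x.
  move=> x01 m n /subnKC <-; elim: (n - m)%N => [|k IH]; first by rewrite addn0.
  by rewrite addnS /S big_ord_recr/= (le_trans IH)// lerDl iter_bump_ge0.
have /compact_near_coveringP nc := @segment_compact R 0 1.
have [J _ SJ] : \forall J \near \oo, forall x, `[0, 1]%classic x -> 
    0 <= x <= 1 -> 0 < S J x.
  apply: nc => x /=; rewrite in_itv/= => x01.
  have [j jx] := iter_bump_gt0 a01 x01.
  have Sx : 0 < S j.+1 x.
    rewrite /S big_ord_recr/= ltr_wpDl// sumr_ge0// => i _; exact: iter_bump_ge0.
  exists ([set y | 0 < S j.+1 y], [set J | (j.+1 <= J)%N]).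
    by split; [exact: (cvgr_gt _ (cS j.+1 x))|exact: nbhs_infty_ge].
  by move=> [y J] /= [Sy jJ] y01; apply: lt_le_trans Sy _; exact: ndS.
have [c c01 Sc] := @EVT_min R (S J) 0 1 ler01 (continuous_subspaceT (@cS J)).
exists J, (S J c); split.
  by apply: (SJ J); rewrite /= -?in_itv//= ?inE//=; move: c01; rewrite in_itv.
by move=> x x01; apply: Sc; rewrite in_itv.
Qed.

(** Let [v] be the Cesaro mean and [y] its maximum point. If [v < v y - r] on (b, a), then
    [v <= v y - r * bump a b]; applying [U^j] and summing over [j < J] loses at least [r * c / 2] at
    [y]. But [U^j v] is within [J / N.+1] of [v], so the loss is at most [J * J / N.+1]. *)
Lemma cesaro_max_near0 a : 0 < a <= 1 ->
  exists2 b, 0 < b < a & forall r, 0 < r -> exists N0, forall N, (N0 <= N)%N ->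
    forall f, bounded_continuous f -> bounds01 f 0 1 ->
    exists2 z, b < z < a &
      forall x, 0 <= x <= 1 -> cesaro U N f x - r <= cesaro U N f z.
Proof.
move=> a01; have [J [c [c0 Sc]]] := sum_iter_bump_gt0 a01.
have J0 : 0 < J%:R :> R.
  case: J Sc => [|J _]; last by rewrite ltr0n.
  by move=> /(_ 0); rewrite big_ord0 lexx ler01 => /(_ isT); lra.
(* Lowering the tent by [b0] costs [J * b0 = c / 2] in the sum, which leaves half of the lower bound
   [c]. *)
pose b0 := c / (2 * J%:R).
have b00 : 0 < b0 by rewrite divr_gt0// mulr_gt0.
have bb0 := @bump_bc R a b0.
have Sb x : 0 <= x <= 1 -> c / 2 <= \sum_(j < J) iter j U (bump a b0) x.
  move=> x01; have := Sc _ x01.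
  have : \sum_(j < J) iter j U (bump a 0) x <=
      \sum_(j < J) (iter j U (bump a b0) x + b0).
    apply: ler_sum => j _; have cb0 := @bounded_continuous_cst R b0.
    rewrite -[X in _ <= _ + X](iter_cst mU j b0 x01).
    have -> : iter j U (bump a b0) x + iter j U (fun=> b0) x =
        iter j U (fun y => bump a b0 y + b0) x by rewrite (iter_opD mU).
    apply: (le_iter mU) => //; [exact: bump_bc|exact: bounded_continuousD|].
    by move=> y _; exact: bump_cut (ltW b00).
  have b0J : b0 *+ J = c / 2 by rewrite -(mulr_natr b0) /b0; field; rewrite gt_eqF.
  by rewrite big_split/= sumr_const card_ord b0J; lra.
have bI : bounds01 (bump a b0) 0 1.
  by move=> x _; rewrite bump_ge0 bump_le1//; lra.
(* A point where the lowered tent is positive shows [b0 < a - b0], hence [b0 < a]. *)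
have [y0 y0b] : exists y, 0 < bump a b0 y.
  apply/not_existsP => bN.
  have b_eq0 : bump a b0 = (fun=> 0).
    apply/funext => y; apply/eqP; rewrite eq_le bump_ge0 andbT leNgt.
    by apply/negP; exact: bN.
  have := @Sb 0; rewrite lexx ler01 => /(_ isT).
  rewrite big1; first lra.
  by move=> j _; rewrite b_eq0 (iter_cst mU)// lexx ler01.
have b0a := bump_support y0b.
exists b0; first lra.
move=> r r0.
(* Chosen so that [J * J / N.+1 < r * c / 2]. *)
pose N0 := Num.bound (2 * J%:R * J%:R / (r * c)).
exists N0 => N N0N f bf f01.
have NJ : J%:R * (J%:R / N.+1%:R) < r * c / 2 :> R.
  have : 2 * J%:R * J%:R / (r * c) < N.+1%:R.
    apply: lt_le_trans (archi_boundP _) _.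
      by rewrite divr_ge0// ?mulr_ge0 ?ltW// mulr_gt0.
    by rewrite ler_nat (leq_trans N0N).
  rewrite ltr_pdivrMr ?mulr_gt0// => h.
  rewrite mulrA ltr_pdivrMr ?ltr0n//; lra.
have [cv _] := cesaro_bc mU N bf.
have [y y01 ymax] := @EVT_max R (cesaro U N f) 0 1 ler01 (continuous_subspaceT cv).
rewrite in_itv/= in y01.
have {}ymax x : 0 <= x <= 1 -> cesaro U N f x <= cesaro U N f y.
  by move=> x01; apply: ymax; rewrite in_itv.
set v := cesaro U N f in cv ymax *.
suff [z zba zmax] : exists2 z, b0 < z < a & v y - r <= v z.
  exists z => // x x01; rewrite (le_trans _ zmax)// lerD2r; exact: ymax.
apply/not_exists2P => vlt.
(* Where the tent is positive, its value is at most 1 and [v] is below [v y - r]; elsewhere the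
   bound is maximality of [y]. *)
have vle x : 0 <= x <= 1 -> v x <= v y + (- r) * bump a b0 x.
  move=> x01; have [bx|bx] := ltP 0 (bump a b0 x).
    have /bump_support xb := bx.
    have := bump_le1 x (_ : a <= 1) (ltW b00).
    case: (vlt x); rewrite ?negP => h; first by lra.
    have : v x < v y - r by rewrite ltNge; apply/negP.
    have {}a1 : a <= 1 by lra.
    move=> vx /(_ a1) b1; have : r * bump a b0 x <= r by rewrite ler_piMr// ltW.
    lra.
  have -> : bump a b0 x = 0 by apply/eqP; rewrite eq_le bx bump_ge0.
  by rewrite mulr0 addr0 ymax.
have Uv j : iter j U v y <= v y - r * iter j U (bump a b0) y.
  have brb := bounded_continuousZ (- r) bb0.
  have bcv := @bounded_continuous_cst R (v y).
  have := le_iter mU j (cesaro_bc mU N bf) (bounded_continuousD bcv brb) vle y01.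
  by rewrite iter_opD// iter_opZ// iter_cst// mulNr.
have lowUv j : (j < J)%N -> v y - J%:R / N.+1%:R <= iter j U v y.
  move=> jJ; have -> : iter j U v y = cesaro U N (iter j U f) y by exact: iter_cesaro.
  have := cesaro_shift mU j N bf f01 y01; rewrite -/v.
  have : j%:R / N.+1%:R <= J%:R / N.+1%:R :> R.
    by rewrite ler_wpM2r ?invr_ge0// ler_nat ltnW.
  set p := j%:R / _; set q := J%:R / _.
  by rewrite ler_norml => pq /andP[]; lra.
have : \sum_(j < J) (v y - J%:R / N.+1%:R) <=
    \sum_(j < J) (v y - r * iter j U (bump a b0) y).
  by apply: ler_sum => j _; exact: le_trans (lowUv j (ltn_ord j)) (Uv j).
rewrite !sumrB !sumr_const card_ord -mulr_sumr lerD2l lerN2 -(mulr_natl (_ / _)).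
rewrite leNgt => /negP; apply; rewrite (lt_le_trans NJ)// -mulrA.
by rewrite ler_wpM2l ?Sb// ltW.
Qed.

End maximum_principle.

(* z 0 >= z' 0 >= z 1 >= z' 1 >= ... in [0,1], up to index m - 1. *)
Definition interlaced {R : realType} m (z z' : nat -> R) :=
  (forall i, (i < m)%N -> 0 <= z' i <= z i /\ z i <= 1) /\
  (forall i, (i.+1 < m)%N -> z i.+1 <= z' i).

Section oscillation.
Context {R : realType} {U : (R -> R) -> R -> R} (mU : markov_operator U).
Implicit Types f h : R -> R.

Context
  (acc : forall x, 0 < x < 1 ->
    exists2 y, 0 < y < 1 & y < x /\ @accessible R U x y)
  (acc0 : exists2 y, 0 < y < 1 & @accessible R U 0 y)
  (acc1 : exists2 y, 0 < y < 1 & @accessible R U 1 y).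

(** Minima are maxima for [1 - f], which again has values in [0,1]; the same [b] serves both because
    it does not depend on [f]. *)
Lemma cesaro_extrema_near0 a : 0 < a <= 1 ->
  exists2 b, 0 < b < a & forall r, 0 < r -> exists N0, forall N, (N0 <= N)%N ->
    forall f, bounded_continuous f -> bounds01 f 0 1 ->
    (exists2 z, b < z < a &
      forall x, 0 <= x <= 1 -> cesaro U N f x - r <= cesaro U N f z) /\
    (exists2 z, b < z < a &
      forall x, 0 <= x <= 1 -> cesaro U N f z <= cesaro U N f x + r).
Proof.
move=> a01; have [b ba hb] := cesaro_max_near0 mU acc acc0 acc1 a01.
exists b => // r r0; have [N0 hN] := hb _ r0; exists N0 => N N0N f bf f01.
split; first exact: hN.
have b1 := @bounded_continuous_cst R 1.
have bNf := bounded_continuousZ (-1) bf.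
have [|z zba zmax] := hN N N0N (fun x => 1 + -1 * f x) (bounded_continuousD b1 bNf).
  by move=> x /f01; lra.
exists z => // x x01; have := zmax _ x01.
rewrite (cesaroD mU)// (cesaroZ mU)// !(cesaro_cst mU)//; lra.
Qed.

(** Each of [m] interlaced pairs of near-extremal points contributes at least the oscillation minus
    [2 * r], while the sum is at most [m * delta + K]. *)
Lemma cesaro_oscillation f delta K : bounded_continuous f -> bounds01 f 0 1 ->
  (forall N m z z', interlaced m z z' ->
    \sum_(i < m) (cesaro U N f (z i) - cesaro U N f (z' i)) <= m%:R * delta + K) ->
  forall eta, 0 < eta -> exists N0, forall N, (N0 <= N)%N ->
    forall x y, 0 <= x <= 1 -> 0 <= y <= 1 ->
    cesaro U N f x - cesaro U N f y <= delta + eta.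
Proof.
move=> bf f01 fK eta eta0.
pose vmax N r b a := exists2 z, b < z < a &
  forall x, 0 <= x <= 1 -> cesaro U N f x - r <= cesaro U N f z.
pose vmin N r b a := exists2 z, b < z < a &
  forall x, 0 <= x <= 1 -> cesaro U N f z <= cesaro U N f x + r.
have [bb bbP] : {bb : R -> R & forall a, 0 < a <= 1 -> 0 < bb a < a /\
  forall r, 0 < r -> exists N0, forall N, (N0 <= N)%N ->
    vmax N r (bb a) a /\ vmin N r (bb a) a}.
  apply: (@choice _ _ (fun a b => 0 < a <= 1 -> 0 < b < a /\
    forall r, 0 < r -> exists N0, forall N, (N0 <= N)%N ->
    vmax N r b a /\ vmin N r b a)) => a.
  have [a01|aN] := pselect (0 < a <= 1); last by exists 0.
  have [b ba hb] := cesaro_extrema_near0 a01; exists b => _; split => // r r0.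
  by have [N0 hN] := hb _ r0; exists N0 => N N0N; exact: hN.
(* These levels do not depend on [N]. In (A i.+1, A i) a near-maximum is taken for even [i] and a
   near-minimum for odd [i], which interlaces them. *)
pose A i := iter i bb 1.
have A01 i : 0 < A i <= 1.
  elim: i => [|i IH]; first by rewrite /= ltr01 lexx.
  by rewrite /A iterS -/(A i); have [] := bbP _ IH; lra.
have AS i : A i.+1 = bb (A i) by rewrite /A iterS.
(* Two thirds of [eta] pay for the near-extremality, one third for [K / m]. *)
pose r := eta / 3; have r0 : 0 < r by rewrite divr_gt0.
have [Nf NfP] : {Nf : nat -> nat & forall i N, (Nf i <= N)%N ->
    vmax N r (A i.+1) (A i) /\ vmin N r (A i.+1) (A i)}.
  apply: (@choice _ _ (fun i N0 => forall N, (N0 <= N)%N ->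
    vmax N r (A i.+1) (A i) /\ vmin N r (A i.+1) (A i))) => i.
  have [_ /(_ _ r0)[N0 hN]] := bbP _ (A01 i).
  by exists N0 => N N0N; rewrite AS; exact: hN.
pose m := (Num.bound (`|K| / r)).+1.
have Km : K <= m%:R * r.
  have : `|K| / r < m%:R.
    apply: lt_le_trans (archi_boundP _) _; first by rewrite divr_ge0// ltW.
    by rewrite ler_nat.
  by rewrite ltr_pdivrMr// => /ltW; apply: le_trans; exact: ler_norm.
exists (\max_(i < m.*2) Nf i)%N => N NN x y x01 y01.
have zP i : (i < m.*2)%N -> (Nf i <= N)%N.
  move=> im; apply: leq_trans NN.
  exact: (@leq_bigmax _ (fun i : 'I_m.*2 => Nf i) (Ordinal im)).
have [z hz] : {z : nat -> R & forall i, (i < m)%N -> A i.*2.+1 < z i < A i.*2 /\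
    cesaro U N f x - r <= cesaro U N f (z i)}.
  apply: (@choice _ _ (fun i t => (i < m)%N -> A i.*2.+1 < t < A i.*2 /\
    cesaro U N f x - r <= cesaro U N f t)) => i.
  have [im|] := ltnP i m; last by exists 0.
  have [|[t ti tmax] _] := NfP i.*2 N; first by apply: zP; rewrite ltn_double.
  by exists t => _; split => //; exact: tmax.
have [z' hz'] : {z' : nat -> R & forall i, (i < m)%N ->
    A i.*2.+2 < z' i < A i.*2.+1 /\ cesaro U N f (z' i) <= cesaro U N f y + r}.
  apply: (@choice _ _ (fun i t => (i < m)%N -> A i.*2.+2 < t < A i.*2.+1 /\
    cesaro U N f t <= cesaro U N f y + r)) => i.
  have [im|] := ltnP i m; last by exists 0.
  have [|_ [t ti tmin]] := NfP i.*2.+1 N; first by apply: zP; rewrite ltn_Sdouble.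
  by exists t => _; split => //; exact: tmin.
have zz' : interlaced m z z'.
  split=> i im.
    have [zi _] := hz _ im; have [zi' _] := hz' _ im.
    have Ai := A01 i.*2; have Ai2 := A01 i.*2.+2.
    by split; lra.
  have [zi _] := hz _ im; have [zi' _] := hz' _ (ltnW im).
  by move: zi zi'; rewrite doubleS; lra.
have := fK N m z z' zz'.
have : \sum_(i < m) (cesaro U N f x - cesaro U N f y - 2 * r) <=
    \sum_(i < m) (cesaro U N f (z i) - cesaro U N f (z' i)).
  apply: ler_sum => i _; have [_ h] := hz _ (ltn_ord i).
  have [_ h'] := hz' _ (ltn_ord i).
  lra.
rewrite sumr_const card_ord -(mulr_natl (_ - _)) => h1 /(le_trans h1) h2.
have m0 : 0 < m%:R :> R by rewrite ltr0n.
have : m%:R * (cesaro U N f x - cesaro U N f y - 2 * r) <= m%:R * (delta + r).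
  by rewrite [leRHS]mulrDr (le_trans h2)// lerD2l.
rewrite ler_pM2l// /r; lra.
Qed.

End oscillation.

(** * Decay of the oscillation *)

Section modulus.
Context {R : realType}.

Lemma uniform_continuity01 (f : R -> R) (eps : R) : continuous f -> 0 < eps ->
  exists n, forall x y, 0 <= x <= 1 -> `|x - y| < n.+1%:R^-1 -> `|f x - f y| < eps.
Proof.
move=> cf eps0; have /compact_near_coveringP nc := @segment_compact R 0 1.
suff [n _ hn] : \forall n \near \oo, forall x, `[0, 1]%classic x -> forall y,
    `|x - y| < n.+1%:R^-1 -> `|f x - f y| < eps.
  by exists n => x y x01; apply: hn => //=; rewrite in_itv.
apply: nc => x _.
have /nbhs_ballP[r /= r0 rf] : \forall t \near x, `|f x - f t| < eps / 2.
  by have /cvgrPdist_lt := cf x; apply; rewrite divr_gt0.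
have r20 : 0 < r / 2 by rewrite divr_gt0.
exists (ball x (r / 2), [set n | n.+1%:R^-1 < r / 2]).
  by split; [exact: nbhsx_ballx|exact: (near_infty_natSinv_lt (PosNum r20))].
move=> [t n] /= [xt nr] y ty.
have xt2 : `|x - t| < r / 2 := xt.
have h1 : `|f x - f t| < eps / 2.
  by apply: rf; rewrite /ball/= (lt_le_trans xt2)// ler_pdivrMr//; lra.
have h2 : `|f x - f y| < eps / 2.
  apply: rf; rewrite /ball/= (le_lt_trans (ler_distD t _ _))//.
  by rewrite [ltRHS](splitr r) ltrD// (lt_trans ty).
rewrite (le_lt_trans (ler_distD (f x) _ _))// [ltRHS](splitr eps) ltrD//.
by rewrite distrC.
Qed.

(** Composing with a merely continuous [f] may destroy bounded variation; being Lipschitz up to an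
    error [eta] is what survives. Beyond the scale [1 / n.+1] of uniform continuity the trivial
    bound [2 * M] is absorbed by the linear term. *)
Lemma affine_modulus (f : R -> R) (eta : R) : bounded_continuous f -> 0 < eta ->
  exists2 L, 0 <= L & forall x y, 0 <= x <= 1 -> 0 <= y <= 1 ->
    `|f x - f y| <= eta + L * `|x - y|.
Proof.
move=> [cf [M fM]] eta0; have [n hn] := uniform_continuity01 cf eta0.
have M0 : 0 <= M by exact: le_trans (fM 0).
exists (2 * M * n.+1%:R) => [|x y x01 y01]; first by rewrite !mulr_ge0.
have [xy|xy] := ltP `|x - y| n.+1%:R^-1.
  by rewrite (le_trans (ltW (hn _ _ x01 xy)))// lerDl !mulr_ge0.
have h : 1 <= n.+1%:R * `|x - y| by rewrite -ler_pdivrMl// mulr1.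
have h2 : `|f x - f y| <= 2 * M.
  by rewrite mulr_natl mulr2n (le_trans (ler_normB _ _))// lerD.
have : 2 * M * 1 <= 2 * M * (n.+1%:R * `|x - y|) by rewrite ler_wpM2l// mulr_ge0.
by rewrite -mulrA mulr1; lra.
Qed.

End modulus.

Section contraction.
Context {R : realType} d (T : measurableType d).
Context (e : T -> R -> R) (ce : forall g, continuous (e g))
  (me : forall x, measurable_fun setT (e ^~ x))
  (e01 : forall g x, 0 <= e g x <= 1).
Context (mu : probability T R) (P : probability (product_space T) R)
  (hP : is_power_measure mu P).
Local Notation U := (transfer e mu).
Local Notation pm := (partial_mean e P).

Lemma transfer_markov : markov_operator U.
Proof.
split.
- exact: transfer_bounded_continuous.
- by move=> f h bf bh; exact: transferD.
- by move=> c f bf; exact: transferZ.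
- by move=> f a b bf fab x x01; apply: (transfer_bounds me) => // g; exact: fab.
Qed.

Let mU := transfer_markov.

Lemma orbit01 w n x : 0 <= x <= 1 -> 0 <= orbit e w n x <= 1.
Proof. by elim: n x => //= n IH x _; exact: IH. Qed.

Lemma partial_mean_bounds (S : set (product_space T)) n (f : R -> R) b x : measurable S ->
  bounded_continuous f -> bounds01 f 0 b -> 0 <= x <= 1 ->
  0 <= pm S n f x <= b * fine (P S).
Proof.
move=> mS [cf _] f01 x01.
rewrite -[X in X <= _](mul0r (fine (P S))).
apply: (@Rintegral_bounds _ _ _ P S (fun w => f (orbit e w n x))) => //.
  exact: measurable_comp_orbit.
by move=> w; apply: f01; exact: orbit01.
Qed.

Let orbit_integrable (S : set (product_space T)) n f x : measurable S ->
  bounded_continuous f -> P.-integrable S (EFin \o (fun w => f (orbit e w n x))).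
Proof.
move=> mS [cf [M fM]]; apply: (@bounded_integrable _ _ _ P S _ M) => //.
exact: measurable_comp_orbit.
Qed.

Lemma partial_mean_setD (S S' : set (product_space T)) n f x : measurable S ->
  measurable S' -> S' `<=` S -> bounded_continuous f ->
  pm S n f x = pm S' n f x + pm (S `\` S') n f x.
Proof.
move=> mS mS' SS' bf; rewrite /partial_mean -Rintegral_setU//.
- by congr Rintegral; apply/esym; exact: setDUK.
- exact: measurableD.
- by rewrite (setDUK SS'); exact: orbit_integrable.
- by apply/disj_setPS => w /= [S'w [_]].
Qed.

(** The variation bound holds path by path on [S]; it is integrated over [S], whose mass is at most
    1. *)
Lemma partial_mean_variation (S : set (product_space T)) n (f : R -> R)
    (eta L K : R) m (z z' : nat -> R) :
  measurable S -> bounded_continuous f -> 0 <= L -> 0 <= K -> 0 <= eta ->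
  (forall x y, 0 <= x <= 1 -> 0 <= y <= 1 -> `|f x - f y| <= eta + L * `|x - y|) ->
  (forall w, S w -> \sum_(i < m) `|orbit e w n (z i) - orbit e w n (z' i)| <= K) ->
  interlaced m z z' ->
  \sum_(i < m) (pm S n f (z i) - pm S n f (z' i)) <= m%:R * eta + L * K.
Proof.
move=> mS bf L0 K0 eta0 fL SK [zz' _].
have int_i i : P.-integrable S (EFin \o
    (fun w => f (orbit e w n (z i)) - f (orbit e w n (z' i)))).
  have := integrableB mS (orbit_integrable n (z i) mS bf)
    (orbit_integrable n (z' i) mS bf).
  by apply: eq_integrable => // w _ /=; rewrite EFinB.
have int_sum k : P.-integrable S (EFin \o (fun w =>
      \sum_(i < k) (f (orbit e w n (z i)) - f (orbit e w n (z' i))))) /\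
    \sum_(i < k) (pm S n f (z i) - pm S n f (z' i)) = \int[P]_(w in S)
      \sum_(i < k) (f (orbit e w n (z i)) - f (orbit e w n (z' i))).
  elim: k => [|k [IH1 IH2]].
    split; last first.
      by under eq_Rintegral do rewrite big_ord0; rewrite big_ord0 Rintegral_cst// mul0r.
    apply: eq_integrable (integrable0 P S) => // w _ /=.
    by rewrite big_ord0.
  rewrite big_ord_recr/= IH2 /partial_mean -RintegralB//; try exact: orbit_integrable.
  rewrite -RintegralD//.
  split; last by apply: eq_Rintegral => w _; rewrite big_ord_recr.
  have := integrableD mS IH1 (int_i k).
  by apply: eq_integrable => // w _ /=; rewrite big_ord_recr/= EFinD.
have [intm ->] := int_sum m.
have c0 : 0 <= m%:R * eta + L * K by rewrite addr_ge0// mulr_ge0.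
apply: (@le_trans _ _ ((m%:R * eta + L * K) * fine (P S))); last first.
  rewrite ler_piMr//.
  by rewrite -[leRHS]/(fine 1%:E) fine_le// ?fin_num_measure// probability_le1.
rewrite -(@Rintegral_cst _ _ _ P)//.
apply: le_Rintegral => //.
  apply: (@bounded_integrable _ _ _ P S (cst _) `|m%:R * eta + L * K|) => //.
move=> w Sw; apply: (@le_trans _ _ (\sum_(i < m)
    (eta + L * `|orbit e w n (z i) - orbit e w n (z' i)|))).
  apply: ler_sum => i _; apply: le_trans (ler_norm _) _; apply: fL.
    by apply: orbit01; have [/andP[zi0 zi1] zi] := zz' i (ltn_ord i); lra.
  by apply: orbit01; have [/andP[zi0 zi1] zi] := zz' i (ltn_ord i); lra.
rewrite big_split/= sumr_const card_ord mulr_natl lerD2l -mulr_sumr.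
by rewrite ler_wpM2l// SK.
Qed.

(** [Bupd] expresses that [B n] is determined by the first [n] coordinates, in the form used by
    [transfer_partial_mean]. *)
Context (B : nat -> set (product_space T)) (K p : R)
  (mB : forall n, measurable (B n))
  (BS : forall n, B n.+1 `<=` B n)
  (Bupd : forall n k w g, (n <= k)%N -> B n (update w k g) <-> B n w)
  (p0 : 0 < p) (pB : forall n, p <= fine (P (B n)))
  (K0 : 0 <= K)
  (BK : forall n w m (z z' : nat -> R), (0 < n)%N -> B n w -> interlaced m z z' ->
    \sum_(i < m) `|orbit e w n (z i) - orbit e w n (z' i)| <= K).
Context
  (acc : forall x, 0 < x < 1 ->
    exists2 y, 0 < y < 1 & y < x /\ @accessible R U x y)
  (acc0 : exists2 y, 0 < y < 1 & @accessible R U 0 y)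
  (acc1 : exists2 y, 0 < y < 1 & @accessible R U 1 y).

Let q n := fine (P (B n)).

Let Bsub n k : B (n + k)%N `<=` B n.
Proof.
elim: k => [|k IH]; first by rewrite addn0.
by rewrite addnS; exact: subset_trans (BS (n := (n + k)%N)) IH.
Qed.

Let q_fin (S : set (product_space T)) : measurable S -> P S \is a fin_num.
Proof. by move=> mS; rewrite fin_num_measure. Qed.

Let qD n k : fine (P (B n `\` B (n + k)%N)) = q n - q (n + k).
Proof.
rewrite measureD//; last by rewrite (le_lt_trans (probability_le1 P (mB n)))// ltry.
have -> : B n `&` B (n + k)%N = B (n + k)%N by rewrite setIidr//; exact: Bsub.
by rewrite fineB// q_fin.
Qed.

Lemma almost_constant_mass eps : 0 < eps ->
  exists2 n, (0 < n)%N & forall k, q n - q (n + k) <= eps.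
Proof.
move=> eps0; pose E := [set q n | n in [set n | (0 < n)%N]].
have infE : has_inf E.
  by split; [exists (q 1%N), 1%N|exists p => _ [n _ <-]; exact: pB].
have [_ [n n0 <-] hn] := inf_adherent eps0 infE.
exists n => // k.
have : inf E <= q (n + k).
  by apply: (ge_inf infE.2); exists (n + k)%N; rewrite //= ltn_addr.
lra.
Qed.

(** The orbit grows by [k] maps while the event stays frozen at time [n]. *)
Lemma iter_partial_mean n k f : bounded_continuous f ->
  iter k U (pm (B n) n f) = pm (B n) (n + k) f.
Proof.
move=> bf; elim: k => [|k IH]; first by rewrite addn0.
rewrite iterS IH addnS; apply: transfer_partial_mean => //.
by move=> w g; apply: Bupd; rewrite leq_addr.
Qed.

(** The comparison [W <= cesaro U N psi <= W + eps] is one-sided, so passing to [W] costs [eps] per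
    pair instead of [2 * eps]. The remaining [eta / 2] per pair is the error of [affine_modulus]. *)
Lemma partial_mean_oscillation n f eps : (0 < n)%N ->
  (forall k, q n - q (n + k) <= eps) -> bounded_continuous f -> bounds01 f 0 1 ->
  forall eta, 0 < eta -> exists N0, forall N, (N0 <= N)%N ->
    forall x y, 0 <= x <= 1 -> 0 <= y <= 1 ->
    cesaro U N (pm (B n) n f) x - cesaro U N (pm (B n) n f) y <= eps + eta.
Proof.
move=> n0 heps bf f01 eta eta0.
pose psi := pm (B n) n f.
have bpsi : bounded_continuous psi by exact: partial_mean_bounded_continuous.
have psi01 : bounds01 psi 0 1.
  move=> x x01; have /andP[-> /le_trans] /= := partial_mean_bounds n (mB n) bf f01 x01.
  apply; rewrite mul1r -[leRHS]/(fine 1%:E) fine_le// ?fin_num_measure//.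
  exact: probability_le1.
have eta20 : 0 < eta / 2 by rewrite divr_gt0.
have [L L0 fL] := affine_modulus bf eta20.
suff main N m (z z' : nat -> R) : interlaced m z z' ->
    \sum_(i < m) (cesaro U N psi (z i) - cesaro U N psi (z' i)) <=
    m%:R * (eps + eta / 2) + L * K.
  have [N0 hN] := cesaro_oscillation mU acc acc0 acc1 bpsi psi01 main eta20.
  by exists N0 => N /hN h x y x01 y01; have := h x y x01 y01; rewrite -/psi; lra.
move=> zz'.
pose W x := N.+1%:R^-1 * \sum_(k < N.+1) pm (B (n + k)%N) (n + k) f x.
have vW x : 0 <= x <= 1 -> W x <= cesaro U N psi x <= W x + eps.
  move=> x01.
  have N10 : 0 < N.+1%:R :> R by rewrite ltr0n.
  have epsE : eps = N.+1%:R^-1 * \sum_(k < N.+1) eps.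
    by rewrite sumr_const card_ord -(mulr_natl eps) mulKf// gt_eqF.
  rewrite epsE /W /cesaro -mulrDr -big_split/= !ler_pM2l ?invr_gt0//.
  have term k : pm (B (n + k)%N) (n + k) f x <= iter k U psi x <=
      pm (B (n + k)%N) (n + k) f x + eps.
    rewrite iter_partial_mean// (@partial_mean_setD (B n) (B (n + k)%N))//.
    have /andP[h0 h] := @partial_mean_bounds (B n `\` B (n + k)%N) (n + k) f 1 x
      (measurableD (mB n) (mB _)) bf f01 x01.
    by rewrite lerDl h0 lerD2l (le_trans h)// mul1r qD.
  by apply/andP; split; apply: ler_sum => k _; have /andP[] := term k.
have z01 i : (i < m)%N -> 0 <= z i <= 1 /\ 0 <= z' i <= 1.
  by move=> im; have [/andP[? ?] ?] := zz'.1 i im; split; lra.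
apply: (@le_trans _ _ (\sum_(i < m) (W (z i) - W (z' i) + eps))).
  apply: ler_sum => i _; have [/vW + /vW] := z01 i (ltn_ord i).
  by move=> /andP[_ h1] /andP[h2 _]; lra.
rewrite big_split/= sumr_const card_ord -(mulr_natl eps) mulrDr -addrA addrC lerD2l.
have -> : \sum_(i < m) (W (z i) - W (z' i)) = N.+1%:R^-1 * \sum_(k < N.+1)
    \sum_(i < m) (pm (B (n + k)%N) (n + k) f (z i) - pm (B (n + k)%N) (n + k) f (z' i)).
  rewrite exchange_big/= mulr_sumr; apply: eq_bigr => i _.
  by rewrite sumrB mulrBr.
rewrite ler_pdivrMl ?ltr0n//.
have -> : N.+1%:R * (m%:R * (eta / 2) + L * K) =
    \sum_(k < N.+1) (m%:R * (eta / 2) + L * K).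
  by rewrite sumr_const card_ord -(mulr_natl (_ + _)).
apply: ler_sum => k _; apply: partial_mean_variation => //; first exact: ltW.
by move=> w Bw; apply: BK Bw zz'; rewrite ltn_addr.
Qed.

(** A uniform bound [s] on the limsup of the oscillations, with the slack [eta] in place of a
    limsup; [N0] may depend on [f]. *)
Let osc_le s := forall f, bounded_continuous f -> bounds01 f 0 1 ->
  forall eta, 0 < eta -> exists N0, forall N, (N0 <= N)%N ->
    forall x y, 0 <= x <= 1 -> 0 <= y <= 1 ->
    cesaro U N f x - cesaro U N f y <= s + eta.

(* The minimum makes 1 - p' nonzero, for the rescaling of the error term. *)
Let p' := Num.min p 2^-1.
Let p'0 : 0 < p'. Proof. by rewrite lt_min p0 invr_gt0/=. Qed.
Let p'1 : 0 < 1 - p'.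
Proof.
rewrite subr_gt0 (@le_lt_trans _ _ 2^-1)//; first by rewrite ge_min lexx orbT.
by rewrite invf_lt1// ltr1n.
Qed.
Let pp' : p' <= p. Proof. by rewrite ge_min lexx. Qed.

Let p'le1 : 1 - p' <= 1. Proof. by rewrite gerBl ltW. Qed.

Lemma oscillation_contraction s eps : osc_le s -> 0 < eps ->
  osc_le ((1 - p') * s + eps).
Proof.
move=> os eps0 f bf f01 eta eta0.
have [n n0 qn] := almost_constant_mass eps0.
pose h := pm (~` B n) n f.
have mCB : measurable (~` B n) by exact: measurableC.
have bh : bounded_continuous h by exact: partial_mean_bounded_continuous.
have h01 x : 0 <= x <= 1 -> 0 <= h x <= 1 - p'.
  move=> x01; have /andP[-> /le_trans] /= := partial_mean_bounds n mCB bf f01 x01.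
  apply; rewrite mul1r probability_setC// fineB// ?q_fin//.
  by have := pB n; have := pp' ; rewrite -[fine 1%E]/(1 : R); lra.
have UfE : iter n U f = (fun x => pm (B n) n f x + h x).
  rewrite (iter_transfer ce me hP)//; apply/funext => x.
  by rewrite (@partial_mean_setD setT (B n))// setTD.
have bh' := bounded_continuousZ (1 - p')^-1 bh.
have h'01 : bounds01 (fun x => (1 - p')^-1 * h x) 0 1.
  move=> x /h01; rewrite ler_pdivrMl// mulr1 => /andP[h0 ->].
  by rewrite mulr_ge0// invr_ge0 ltW.
(* The quarters pay for the oscillation of the mean of [pm (B n) n f], that of [h], and the shift by
   [n] at [x] and at [y]. *)
have eta40 : 0 < eta / 4 by rewrite divr_gt0.
have [N1 hN1] := partial_mean_oscillation n0 qn bf f01 eta40.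
have [N2 hN2] := os _ bh' h'01 _ eta40.
pose N3 := Num.bound (n%:R / (eta / 4)).
exists (maxn (maxn N1 N2) N3) => N; rewrite !geq_max => /andP[/andP[NN1 NN2] NN3].
move=> x y x01 y01.
have osc1 := hN1 N NN1 x y x01 y01.
have osc2 := hN2 N NN2 x y x01 y01.
rewrite !(cesaroZ mU)// -mulrBr ler_pdivrMl// in osc2.
have n_small : n%:R / N.+1%:R <= eta / 4 :> R.
  rewrite ler_pdivrMr ?ltr0n// mulrC -ler_pdivrMr//.
  apply: le_trans (ltW (archi_boundP _)) _; first by rewrite divr_ge0// ltW.
  by rewrite ler_nat (leq_trans NN3).
have shx := le_trans (cesaro_shift mU n N bf f01 x01) n_small.
have shy := le_trans (cesaro_shift mU n N bf f01 y01) n_small.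
have bpsi : bounded_continuous (pm (B n) n f).
  exact: partial_mean_bounded_continuous.
move: shx shy; rewrite UfE !(cesaroD mU)//.
rewrite !ler_norml => /andP[? ?] /andP[? ?].
have : (1 - p') * (s + eta / 4) <= (1 - p') * s + eta / 4.
  by rewrite mulrDr lerD2l; exact: ler_piMl (ltW eta40) p'le1.
lra.
Qed.

Lemma cesaro_oscillation0 f : bounded_continuous f -> bounds01 f 0 1 ->
  forall eta, 0 < eta -> exists N0, forall N, (N0 <= N)%N ->
    forall x y, 0 <= x <= 1 -> 0 <= y <= 1 ->
    cesaro U N f x - cesaro U N f y <= eta.
Proof.
move=> bf f01 eta eta0.
pose E := [set s | 0 <= s /\ osc_le s].
have E1 : E 1.
  split=> // h bh h01 r r0; exists 0%N => N _ x y x01 y01.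
  have /andP[? ?] := cesaro_bounds mU N bh h01 x01.
  have /andP[? ?] := cesaro_bounds mU N bh h01 y01.
  lra.
have infE : has_inf E by split; [exists 1|exists 0 => s []].
have inf0 : 0 <= inf E by apply: lb_le_inf; [exists 1|move=> s []].
have {inf0} infE0 : inf E = 0.
  apply/eqP; rewrite eq_le inf0 andbT leNgt; apply/negP => i0.
  (* Writing [i] for the infimum, [s < i + t] and the contraction give [i <= (1 - p') * (i + t) + t
     <= i - p' * i + 2 * t], which is below [i] for this [t]. *)
  pose t := p' * inf E / 4; have t0 : 0 < t by rewrite divr_gt0// mulr_gt0.
  have [s [s0 os] si] := inf_adherent t0 infE.
  have : inf E <= (1 - p') * s + t.
    apply: (ge_inf infE.2); split; last exact: oscillation_contraction.
    by rewrite addr_ge0 ?mulr_ge0// ltW.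
  have : (1 - p') * s <= (1 - p') * (inf E + t) by rewrite ler_wpM2l// ltW.
  have : (1 - p') * t <= t by exact: ler_piMl (ltW t0) p'le1.
  have : 0 < p' * inf E by rewrite mulr_gt0.
  have : 4 * t = p' * inf E by rewrite /t; field.
  by move: (p') (inf E) (t) => u v w; rewrite !mulrBl !mul1r !mulrDr; lra.
have eta20 : 0 < eta / 2 by rewrite divr_gt0.
have [s [s0 os] si] := inf_adherent eta20 infE.
have [N0 hN] := os f bf f01 _ eta20.
exists N0 => N /hN h x y x01 y01; apply: le_trans (h x y x01 y01) _.
by move: si; rewrite infE0; lra.
Qed.

End contraction.

(** * The evaluation maps *)

Section borel.
Context {R : realType}.

Lemma measurable_from_open d (T : measurableType d) (X : ptopologicalType)
    (f : T -> X) :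
  (forall A : set X, open A -> measurable (f @^-1` A)) ->
  measurable_fun setT (f : T -> borel X).
Proof.
move=> fo; apply: (@measurability _ _ T (borel X) setT _ (@open X)) => //.
by move=> _ [A oA <-]; rewrite setTI; exact: fo.
Qed.

Lemma open_borel (X : ptopologicalType) (A : set X) : open A ->
  measurable (A : set (borel X)).
Proof. by move=> oA; exact: sub_sigma_algebra. Qed.

Lemma continuous_borel (X : ptopologicalType) (f : X -> R) : continuous f ->
  measurable_fun setT (f : borel X -> R).
Proof.
move=> /continuousP cf.
apply: (measurability _ (RGenOInfty.measurableE R)) => //.
move=> _ [_ [x ->] <-]; rewrite setTI; apply: open_borel; apply: cf.
exact: interval_open.
Qed.

End borel.

Section unit_interval.
Context {R : realType}.

Definition clamp (t : R) := Num.max 0 (Num.min 1 t).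

Lemma clamp01 t : 0 <= clamp t <= 1.
Proof. by rewrite le_max lexx ge_max ler01 ge_min lexx. Qed.

Lemma clamp_id t : 0 <= t <= 1 -> clamp t = t.
Proof. by move=> /andP[t0 t1]; rewrite /clamp (min_idPr _)// (max_idPr _). Qed.

Lemma continuous_clamp : continuous clamp.
Proof.
have c1 : continuous (fun t : R => Num.min 1 t).
  by apply: continuous_minr => t; [exact: cvg_cst|exact: cvg_id].
by apply: continuous_maxr => // t; exact: cvg_cst.
Qed.

Lemma mem_clamp t : clamp t \in [set` `[0%R : R, 1%R]].
Proof. by rewrite inE /= in_itv /= clamp01. Qed.

Definition toI01 (t : R) : I01 R := exist _ (clamp t) (mem_clamp t).

Lemma toI01K (x : I01 R) : toI01 (\val x) = x.
Proof. by apply: val_inj => /=; rewrite clamp_id// I01_itv. Qed.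

Lemma continuous_val : continuous (fun x : I01 R => \val x).
Proof. exact: (@initial_continuous (I01 R) R \val). Qed.

Lemma continuous_toI01 : continuous toI01.
Proof.
apply: (@continuous_comp_initial _ _ _ (\val : I01 R -> R)).
exact: continuous_clamp.
Qed.

End unit_interval.

Section evaluation.
Context {R : realType}.

Lemma sup_dist_ge (g h : C01 R) x : `|\val (g x) - \val (h x)| <= sup_dist g h.
Proof.
apply: ub_le_sup; last by exists x.
exists 1 => _ [y _ <-].
have := I01_itv (g y); have := I01_itv (h y).
by rewrite ler_norml; lra.
Qed.

(* Self-maps of [0,1] are turned into maps of the line by precomposing with
   the retraction [clamp]. *)
Definition ev (g : C01 R) (t : R) : R := \val (g (toI01 t)).

Lemma ev01 g t : 0 <= ev g t <= 1. Proof. exact: I01_itv. Qed.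

Lemma ev_val g x : ev g (\val x) = \val (g x).
Proof. by rewrite /ev toI01K. Qed.

Lemma continuous_ev g : continuous (ev g).
Proof.
move=> t; apply: (@continuous_comp _ _ _ toI01 (fun x => \val (g x))).
  exact: continuous_toI01.
apply: (@continuous_comp _ _ _ g \val); last exact: continuous_val.
exact: cts_fun.
Qed.

Lemma continuous_ev_fun t : continuous (ev ^~ t).
Proof.
move=> g A /nbhs_ballP[eps eps0 epsA].
apply/nbhs_ballP; exists eps => //= h gh; apply: epsA.
exact: le_lt_trans (sup_dist_ge g h (toI01 t)) gh.
Qed.

Lemma measurable_ev t : measurable_fun setT ((ev ^~ t) : borel (C01 R) -> R).
Proof. by apply: continuous_borel; exact: continuous_ev_fun. Qed.

(** The maps sending [x] to a point where [f] exceeds half of [f (ev g x)] form an open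
    neighbourhood of [g], which has positive mass because [g] is in the support. *)
Lemma transfer_gt0 (mu : probability (borel (C01 R)) R) g f x :
  msupport mu g -> bounded_continuous f ->
  (forall z, 0 <= z <= 1 -> 0 <= f z) -> 0 < f (ev g x) ->
  0 < transfer (ev : borel (C01 R) -> R -> R) mu f x.
Proof.
move=> gS bf f0 fg; pose c := f (ev g x) / 2.
have c0 : 0 < c by rewrite divr_gt0.
have [cf [M fM]] := bf.
pose V := [set h : C01 R | c < f (ev h x)].
have oV : open V.
  have /continuousP : continuous (fun h => f (ev h x)).
    move=> h; apply: (@continuous_comp _ _ _ (ev ^~ x) f); last exact: cf.
    exact: continuous_ev_fun.
  by move=> /(_ _ (@open_gt _ c)).
have mV : measurable (V : set (borel (C01 R))) by exact: open_borel.
have Vg : V g by rewrite /V/= /c; lra.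
have muV := gS V oV Vg.
have mf := measurable_comp_e measurable_ev x cf.
apply: (@lt_le_trans _ _ (c * fine (mu V))).
  rewrite mulr_gt0// fine_gt0// muV/=.
  by rewrite (le_lt_trans (probability_le1 mu mV))// ltry.
rewrite /transfer -(setUv V) Rintegral_setU//.
- rewrite -[leLHS]addr0 lerD//.
    rewrite -(Rintegral_cst mu mV); apply: le_Rintegral => //.
      by apply: (@bounded_integrable _ _ _ mu V (cst c) `|c|) => //.
      exact: (@bounded_integrable _ _ _ mu V _ M).
    by move=> h /ltW.
  by apply: Rintegral_ge0 => h _; apply: f0; exact: ev01.
- exact: measurableC.
- by rewrite setUv; exact: (@bounded_integrable _ _ _ mu setT _ M).
- by apply/disj_setPS => h [].
Qed.

End evaluation.

(** * Total variation on grids *)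

Section total_variation.
Context {R : realType}.
Implicit Types f h : R -> R.

Lemma interlaced_variation f K m (z z' : nat -> R) :
  (total_variation 0 1 f <= K%:E)%E -> interlaced m z z' ->
  \sum_(i < m) `|f (z i) - f (z' i)| <= K.
Proof.
move=> fK.
(* The pairs run from right to left: [c m] is the leftmost point of the first [m] pairs, and their
   sum is bounded by the variation on [c m, 1]. *)
pose c m := if m is k.+1 then z' k else 1.
suff main : interlaced m z z' -> 0 <= c m <= 1 /\
    ((\sum_(i < m) `|f (z i) - f (z' i)|)%:E <= total_variation (c m) 1 f)%E.
  move=> /main [/andP[c0 c1] h]; rewrite -lee_fin (le_trans h)// (le_trans _ fK)//.
  by rewrite (total_variationD _ c0 c1) leeDr// total_variation_ge0.
elim: m => [|m IH] [h1 h2].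
  by rewrite big_ord0 /= ler01 lexx total_variationxx.
have [/andP[c0 c1] IHm] : 0 <= c m <= 1 /\
    ((\sum_(i < m) `|f (z i) - f (z' i)|)%:E <= total_variation (c m) 1 f)%E.
  by apply: IH; split => i im; [apply: h1|apply: h2]; exact: ltnW.
have [/andP[z'0 z'z] z1] := h1 m (ltnSn m).
have zc : z m <= c m by case: m {IH h1 IHm c0 c1 z'0 z'z} z1 h2 => [//|m] _; exact.
split; first by rewrite /= z'0 (le_trans z'z).
rewrite /= big_ord_recr/= EFinD addeC.
rewrite (total_variationD _ z'z z1) leeD// ?total_variation_ge//.
by rewrite (total_variationD _ zc c1) (le_trans IHm)// leeDr// total_variation_ge0.
Qed.

Definition grid_variation n f :=
  \sum_(i < n.+1) `|f (i.+1%:R / n.+1%:R) - f (i%:R / n.+1%:R)|.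

Lemma grid_variation_le f K n :
  (total_variation 0 1 f <= K%:E)%E -> grid_variation n f <= K.
Proof.
(* Interlaced points decrease, so the grid is listed from 1 down to 0, each cell being one pair. *)
move=> fK; pose z i : R := (n.+1 - i)%:R / n.+1%:R.
have n0 : 0 < n.+1%:R :> R by rewrite ltr0n.
have zz' : interlaced n.+1 z (fun i => z i.+1).
  split=> // i im; rewrite /z; split.
    rewrite divr_ge0//= ler_pM2r ?invr_gt0// ler_nat leq_sub2l//.
  by rewrite ler_pdivrMr// mul1r ler_nat leq_subr.
rewrite (le_trans _ (interlaced_variation fK zz'))// /grid_variation.
rewrite (reindex_inj rev_ord_inj)/= le_eqVlt; apply/orP; left; apply/eqP.
by apply: eq_bigr => i _; rewrite /z subSS -subSn// -ltnS.
Qed.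

Lemma sum_dist_telescope (G : nat -> R) (a : nat -> nat) k :
  (forall i, (a i <= a i.+1)%N) ->
  \sum_(0 <= i < k) `|G (a i.+1) - G (a i)| <= \sum_(a 0 <= j < a k) `|G j.+1 - G j|.
Proof.
move=> aS.
have a0k n : (a 0 <= a n)%N by elim: n => // n IH; exact: leq_trans IH (aS n).
elim: k => [|k IH]; first by rewrite !big_geq.
rewrite big_nat_recr//= (big_cat_nat (a0k k) (aS k))/= lerD//.
by rewrite -telescope_sumr// ler_norm_sum.
Qed.

(** By continuity, rounding the points of a partition down to finer and finer grids recovers its
    variation in the limit. Only countably many sums then matter, which makes variation bounds
    measurable events. The continuous [h] stands in for [f], which may jump at the ends of [0,1]. *)
Lemma total_variation_le_grid f h K : continuous h ->
  (forall t, 0 <= t <= 1 -> f t = h t) -> (forall n, grid_variation n f <= K) ->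
  (total_variation 0 1 f <= K%:E)%E.
Proof.
move=> ch fh fK; apply: ge_ereal_sup => _ [_ [s [ps /eqP ls] <-] <-].
(* Past the end of the partition [x] takes the default 1, its last point, and so stays monotone. *)
rewrite lee_fin /variation/=; set x := nth 1 (0 :: s).
have s0 : (0 < size s)%N.
  by case: s ps ls {x} => //= _ /eqP; rewrite eq_sym oner_eq0.
have xle i j : (i <= j)%N -> x i <= x j.
  move=> ij; rewrite /x; have [js|js] := ltnP j (size (0 :: s)).
    have ss : sorted <=%R (0 :: s).
      by rewrite /=; apply: sub_path ps => u v; exact: ltW.
    apply: (sorted_leq_nth le_trans lexx 1 ss) => //; exact: leq_ltn_trans ij js.
  rewrite [leRHS]nth_default//.
  have [is_|is_] := ltnP i (size (0 :: s)); last by rewrite nth_default.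
  rewrite -[leRHS]ls -nth_last/=.
  have ss : sorted <=%R (0 :: s).
    by rewrite /=; apply: sub_path ps => u v; exact: ltW.
  have -> : nth 0 s (size s).-1 = nth 1 (0 :: s) (size s).
    by case: s s0 {x ps ls js is_ ss} => //= u s _; exact: set_nth_default.
  exact: (sorted_leq_nth le_trans lexx 1 ss i (size s) is_ (ltnSn _) is_).
have x01 i : 0 <= x i <= 1.
  have -> : 0 = x 0%N by [].
  have -> : 1 = x (maxn i (size s).+1) by rewrite /x nth_default// leq_maxr.
  by rewrite !xle// leq_maxl.
rewrite (eq_big_nat _ _ (F2 := fun n => `|h (x n.+1) - h (x n)|)); last first.
  by move=> i _; congr (`| _ - _ |); [exact: fh (x01 i.+1)|exact: fh (x01 i)].
have cvg_var : \sum_(0 <= i < size s) `|h (grid N (x i.+1)) - h (grid N (x i))|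
    @[N --> \oo] --> \sum_(0 <= i < size s) `|h (x i.+1) - h (x i)|.
  have hg t : h (grid N t) @[N --> \oo] --> h t.
    by apply: (@cvg_comp _ _ _ (fun N => grid N t) h); [exact: cvg_grid|exact: ch].
  elim: (size s) => [|k IH].
    by under eq_fun do rewrite big_geq//; rewrite big_geq//; exact: cvg_cst.
  under eq_fun do rewrite big_nat_recr//=.
  by rewrite big_nat_recr//=; apply: cvgD => //; apply: cvg_norm; apply: cvgB; exact: hg.
apply: (closed_cvg (fun y => y <= K) (@closed_le R K) _ _ cvg_var).
apply: nearW => N.
apply: le_trans (fK N).
(* The index of the grid point below [x i]; increments of the rounded partition are sums of
   consecutive grid increments. *)
pose a i := `|Num.floor (N.+1%:R * x i)|%N.
have aE i : (a i)%:R = (Num.floor (N.+1%:R * x i))%:~R :> R.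
  rewrite /a natr_absz ger0_norm// floor_ge0 mulr_ge0//.
  by have /andP[] := x01 i.
have aN i : (a i <= N.+1)%N.
  rewrite -(ler_nat R) aE; have /andP[fl _] := floor_itv (N.+1%:R * x i).
  by rewrite (le_trans fl)// ler_piMr//; have /andP[] := x01 i.
have aS i : (a i <= a i.+1)%N.
  rewrite -(ler_nat R) !aE ler_int; apply: le_floor.
  by rewrite ler_pM2l ?ltr0n// xle.
pose G j := f (j%:R / N.+1%:R).
have G01 j : (j <= N.+1)%N -> G j = h (j%:R / N.+1%:R).
  move=> jN; rewrite /G fh// divr_ge0//= ler_pdivrMr ?ltr0n// mul1r ler_nat//.
have hG i : h (grid N (x i)) = G (a i) by rewrite G01// aE.
under eq_bigr do rewrite !hG.
apply: le_trans (sum_dist_telescope G _ aS) _.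
rewrite /grid_variation -(big_mkord xpredT (fun i => `|G i.+1 - G i|)).
rewrite [leRHS](big_cat_nat (n := a 0%N))//= ler_wpDl ?sumr_ge0//.
rewrite [leRHS](big_cat_nat (n := a (size s)))//=; last first.
  by elim: (size s) => // k IH; exact: leq_trans IH (aS k).
by rewrite ler_wpDr// sumr_ge0.
Qed.

End total_variation.

(** * The variation events and the full mass of the support *)

Section bounded_variation.
Context {R : realType}.
Implicit Types w : nat -> C01 R.
Local Notation orb := (orbit (ev : borel (C01 R) -> R -> R)).

Lemma orbitSl w n x : orb w n.+1 x = ev (w 0%N) (orb (fun i => w i.+1) n x).
Proof. by elim: n x => //= n IH x; rewrite -IH. Qed.

Lemma val_prefix_comp w n x : \val (prefix_comp w n x) = orb w n (\val x).
Proof.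
rewrite /prefix_comp; elim: n w => [|n IH] w; first by rewrite big_ord0.
by rewrite big_ord_recl orbitSl -(IH (fun i => w i.+1)) ev_val.
Qed.

Lemma extend01_prefix w n t : 0 <= t <= 1 ->
  extend01 (prefix_comp w n) t = orb w n t.
Proof.
move=> t01; have tE : t = \val (toI01 t) by rewrite /= clamp_id.
by rewrite tE extend01E val_prefix_comp.
Qed.

Lemma measurable_TV01_le n (K : R) : measurable
  ([set w | (TV01 (prefix_comp w n) <= K%:E)%E] : set (product_space (borel (C01 R)))).
Proof.
have -> : [set w | (TV01 (prefix_comp w n) <= K%:E)%E] =
    \bigcap_N [set w | grid_variation N (extend01 (prefix_comp w n)) <= K].
  apply/seteqP; split=> w /=; first by move=> h N _; exact: grid_variation_le.
  move=> h; apply: (@total_variation_le_grid _ _ (orb w n)).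
  - exact: (@continuous_orbit R _ (borel (C01 R)) ev (@continuous_ev R)).
  - exact: extend01_prefix.
  - by move=> N; exact: h.
apply: bigcapT_measurable => N.
have grid01 i : (i <= N.+1)%N -> 0 <= (i%:R / N.+1%:R : R) <= 1.
  by move=> iN; rewrite divr_ge0//= ler_pdivrMr ?ltr0n// mul1r ler_nat.
have -> : [set w | grid_variation N (extend01 (prefix_comp w n)) <= K] =
    (fun w => \sum_(i < N.+1) `|orb w n (i.+1%:R / N.+1%:R) - orb w n (i%:R / N.+1%:R)|)
      @^-1` `]-oo, K]%classic.
  have gE w : grid_variation N (extend01 (prefix_comp w n)) =
      \sum_(i < N.+1) `|orb w n (i.+1%:R / N.+1%:R) - orb w n (i%:R / N.+1%:R)|.
    apply: eq_bigr => i _; rewrite !extend01_prefix ?grid01//; exact: ltnW.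
  by apply/seteqP; split=> w /=; rewrite in_itv/= gE.
have : measurable_fun setT (fun w : product_space (borel (C01 R)) =>
   \sum_(i < N.+1) `|orb w n (i.+1%:R / N.+1%:R) - orb w n (i%:R / N.+1%:R)|).
  apply: measurable_sum => i; apply: measurableT_comp => //.
  have mo t := @measurable_orbit R _ (borel (C01 R)) ev (@continuous_ev R)
    (@measurable_ev R) n (cst t) (measurable_cst t).
  by apply: measurable_funB; exact: mo.
move=> mf; rewrite -[X in measurable X]setTI.
by apply: mf => //; exact: measurable_itv.
Qed.

(** Bounding all prefixes up to [n], not just the last one, makes these events decrease with [n]. *)
Definition prefix_TV_le (K : R) n : set (nat -> C01 R) :=
  [set w | forall j, (0 < j <= n)%N -> (TV01 (prefix_comp w j) <= K%:E)%E].

Lemma measurable_prefix_TV_le K n :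
  measurable (prefix_TV_le K n : set (product_space (borel (C01 R)))).
Proof.
have -> : prefix_TV_le K n = \bigcap_j [set w | (0 < j <= n)%N ->
    (TV01 (prefix_comp w j) <= K%:E)%E].
  by apply/seteqP; split => w /= h j; [move=> _; exact: h|exact: h].
apply: bigcapT_measurable => j; have [jn|jn] := boolP (0 < j <= n)%N.
  rewrite (_ : [set w | _] = [set w | (TV01 (prefix_comp w j) <= K%:E)%E]).
    exact: measurable_TV01_le.
  by apply/seteqP; split => w /= h //; exact: h.
rewrite (_ : [set w | _] = setT); first exact: measurableT.
by apply/seteqP; split.
Qed.

Lemma prefix_TV_le_update K n k w g : (n <= k)%N ->
  prefix_TV_le K n (update (T := borel (C01 R)) w k g) <-> prefix_TV_le K n w.
Proof.
move=> nk; suff E j : (j <= n)%N ->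
    prefix_comp (update (T := borel (C01 R)) w k g) j = prefix_comp w j.
  by split=> h j /[dup] /andP[_ jn] /h; rewrite E.
move=> jn; rewrite /prefix_comp; apply: eq_bigr => i _.
by rewrite /update ltn_eqF// (leq_trans (ltn_ord i))// (leq_trans jn).
Qed.

Lemma prefix_TV_le_interlaced (K : R) n w m (z z' : nat -> R) : (0 < n)%N ->
  prefix_TV_le K n w -> interlaced m z z' ->
  \sum_(i < m) `|orb w n (z i) - orb w n (z' i)| <= K.
Proof.
move=> n0 wB zz'; have := wB n; rewrite n0 leqnn => /(_ isT) TVK.
rewrite (le_trans _ (interlaced_variation TVK zz'))//.
apply: ler_sum => i _; have [/andP[z'0 z'z] z1] := zz'.1 i (ltn_ord i).
by rewrite !extend01_prefix//; lra.
Qed.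

Context (mu : probability (borel (C01 R)) R)
  (P : probability (product_space (borel (C01 R))) R)
  (hP : is_power_measure mu P) (hTV : (0 < P (bounded_prefix_TV mu))%E).

Lemma open_msupportC : open (~` msupport mu).
Proof.
rewrite openE => g /= /existsNP[V /not_implyP[oV /not_implyP[Vg muV]]].
rewrite /interior nbhsE; exists V => // h Vh hS; apply: muV; exact: hS.
Qed.

Lemma measurable_msupport : measurable (msupport mu : set (borel (C01 R))).
Proof.
rewrite -[msupport mu]setCK; apply: measurableC.
exact: open_borel open_msupportC.
Qed.

(** A finite supremum is bounded by some integer [k], so the event is built from countably many
    measurable ones. *)
Lemma bounded_prefix_TVE : bounded_prefix_TV mu =
  (\bigcap_i (fun w => w i) @^-1` msupport mu) `&`
  \bigcup_k \bigcap_n prefix_TV_le k%:R n.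
Proof.
apply/seteqP; split=> w /=.
  move=> [wS supw]; split; first by move=> i _; exact: wS.
  set s := ereal_sup _ in supw.
  have sK j : (0 < j)%N -> (TV01 (prefix_comp w j) <= s)%E.
    by move=> j0; apply: ereal_sup_ubound; exists j.
  (* Non-negativity excludes the value -oo, so [s] is finite. *)
  have s0 : (0 <= s)%E.
    by apply: le_trans (sK 1%N isT); exact: total_variation_ge0 ler01.
  have sfin : s \is a fin_num by rewrite ge0_fin_numE.
  exists (Num.bound (fine s)) => // n _ j /andP[j0 _].
  rewrite (le_trans (sK j j0))// -[leLHS]fineK// lee_fin ltW// archi_boundP//.
  exact: fine_ge0.
move=> [wS [k _ wk]]; split; first by move=> i; exact: wS.
apply: (@le_lt_trans _ _ (k%:R%:E)); last exact: ltry.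
by apply: ge_ereal_sup => _ [n /= n0 <-]; apply: (wk n) => //; rewrite n0 leqnn.
Qed.

Lemma measurable_msupport_coordinates :
  measurable (\bigcap_i (fun w => w i) @^-1` msupport mu :
    set (product_space (borel (C01 R)))).
Proof.
apply: bigcapT_measurable => i; rewrite -[X in measurable X]setTI.
by apply: measurable_coordinate => //; exact: measurable_msupport.
Qed.

Lemma measurable_bounded_variation (k : R) :
  measurable (\bigcap_n prefix_TV_le k n : set (product_space (borel (C01 R)))).
Proof. by apply: bigcapT_measurable => n; exact: measurable_prefix_TV_le. Qed.

Lemma measurable_bounded_prefix_TV :
  measurable (bounded_prefix_TV mu : set (product_space (borel (C01 R)))).
Proof.
rewrite bounded_prefix_TVE; apply: measurableI.
  exact: measurable_msupport_coordinates.
by apply: bigcupT_measurable => k; exact: measurable_bounded_variation.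
Qed.

Lemma bounded_variation_gt0 : exists2 K : R, 0 <= K &
  (0 < P (\bigcap_n prefix_TV_le K n))%E.
Proof.
apply/not_exists2P => noK.
have PK (k : nat) : P (\bigcap_n prefix_TV_le k%:R n) = 0%E.
  apply/eqP; rewrite eq_le measure_ge0 andbT leNgt; apply/negP.
  by case: (noK k%:R).
have : (P (bounded_prefix_TV mu) <= \sum_(k <oo) P (\bigcap_n prefix_TV_le k%:R n))%E.
  apply: measure_sigma_subadditive.
  - by move=> k; exact: measurable_bounded_variation.
  - exact: measurable_bounded_prefix_TV.
  - by rewrite bounded_prefix_TVE; exact: subIsetr.
rewrite eseries0; last by move=> k _ _; exact: PK.
by rewrite leNgt hTV.
Qed.

(* C([0,1]) need not be shown separable: the event of positive probability in
   [hTV] lies in the product of n copies of the support, for every n. *)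
Lemma msupport_full : mu (msupport mu) = 1%E.
Proof.
pose q := fine (mu (msupport mu)).
have mS := measurable_msupport.
have qE : mu (msupport mu) = q%:E by rewrite fineK// fin_num_measure.
have q0 : 0 <= q by rewrite fine_ge0.
have q1 : q <= 1 by rewrite -lee_fin -qE probability_le1.
suff : q = 1 by rewrite qE => ->.
apply/eqP; rewrite eq_le q1 leNgt; apply/negP => q_lt1.
pose p := fine (P (bounded_prefix_TV mu)).
have mB := measurable_bounded_prefix_TV.
have pE : P (bounded_prefix_TV mu) = p%:E by rewrite fineK// fin_num_measure.
have p0 : 0 < p by rewrite -lte_fin -pE.
have pq n : p <= q ^+ n.
  rewrite -lee_fin -pE.
  have -> : (q ^+ n)%:E = P [set w | forall i, (i < n)%N -> msupport mu (w i)].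
    have /= -> := hP n (B := fun=> msupport mu) (fun=> mS).
    by rewrite qE prodEFin prodr_const card_ord.
  apply: le_measure; rewrite ?inE//.
    by apply: (@measurable_rectangle _ (borel (C01 R)) n (fun=> msupport mu)).
  by move=> w [wS _] i _; exact: wS.
have /cvgrPdist_lt/(_ _ p0)[n _ /(_ n (leqnn n))] : (q ^+ n) @[n --> \oo] --> 0.
  by apply: cvg_expr; rewrite ger0_norm.
by rewrite sub0r normrN ger0_norm ?exprn_ge0// ltNge pq.
Qed.

Context
  (U1 : forall x : I01 R, 0 < \val x < 1 ->
    exists2 g : C01 R, msupport mu g & \val (g x) < \val x)
  (hint : forall g : C01 R, msupport mu g ->
    forall x : I01 R, 0 < \val x < 1 -> 0 < \val (g x) < 1)
  (h0 : exists2 g : C01 R, msupport mu g & 0 < \val (g i0) < 1)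
  (h1 : exists2 g : C01 R, msupport mu g & 0 < \val (g i1) < 1).

Local Notation U := (transfer (ev : borel (C01 R) -> R -> R) mu).

Lemma ev_accessible g x : msupport mu g -> @accessible R U x (ev g x).
Proof. by move=> gS f bf f0 fg; exact: transfer_gt0 gS bf f0 fg. Qed.

Lemma mean_oscillation f : bounded_continuous f -> bounds01 f 0 1 ->
  forall eta, 0 < eta -> exists N0, forall N, (N0 <= N)%N ->
    forall x y, 0 <= x <= 1 -> 0 <= y <= 1 ->
    cesaro U N f x - cesaro U N f y <= eta.
Proof.
have [K K0 PK] := bounded_variation_gt0.
have mK := measurable_bounded_variation K.
(* The intersection lies in every [prefix_TV_le K n], so its mass is a common lower bound. *)
pose p := fine (P (\bigcap_n prefix_TV_le K n)).
have p0 : 0 < p.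
  by rewrite fine_gt0// PK/= (le_lt_trans (probability_le1 P mK))// ltry.
apply: (@cesaro_oscillation0 R _ (borel (C01 R)) ev (@continuous_ev R)
  (@measurable_ev R) (@ev01 R) mu P hP (prefix_TV_le K) K p).
- exact: measurable_prefix_TV_le.
- by move=> n w wB j /andP[j0 jn]; apply: wB; rewrite j0 ltnW.
- by move=> n k w g nk; exact: prefix_TV_le_update.
- exact: p0.
- move=> n; rewrite /p fine_le ?fin_num_measure//.
  + exact: measurable_prefix_TV_le.
  + apply: le_measure; rewrite ?inE//; first exact: measurable_prefix_TV_le.
    by move=> w; exact.
- exact: K0.
- by move=> n w m z z'; exact: prefix_TV_le_interlaced.
- move=> x x01; have xE : x = \val (toI01 x) by rewrite /= clamp_id//; lra.
  have [|g gS gx] := U1 (x := toI01 x); first by rewrite -xE.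
  exists (ev g x); first by apply: (hint gS); rewrite -xE.
  by split; [rewrite [ltRHS]xE|exact: ev_accessible].
- have [g gS g0] := h0; exists (ev g 0); last exact: ev_accessible.
  by have := ev_val g i0 => /= ->.
- have [g gS g1] := h1; exists (ev g 1); last exact: ev_accessible.
  by have := ev_val g i1 => /= ->.
Qed.

End bounded_variation.

(** * Measures on [0,1] as means of continuous functions *)

Section ramp.
Context {R : realType}.

(** For [t < c], a continuous function between the indicators of ]-oo, t] and ]-oo, c[. *)
Definition ramp (t c x : R) := clamp ((c - x) / (c - t)).

Lemma ramp01 t c x : 0 <= ramp t c x <= 1.
Proof. exact: clamp01. Qed.

Lemma ramp_bc t c : bounded_continuous (ramp t c).
Proof.
split; last first.
  by exists 1 => x; have /andP[r0 r1] := ramp01 t c x; rewrite ger0_norm.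
move=> x; apply: (@continuous_comp _ _ _ (fun x => (c - x) / (c - t)) clamp).
  by apply: cvgM; [apply: cvgB; [exact: cvg_cst|exact: cvg_id]|exact: cvg_cst].
exact: continuous_clamp.
Qed.

Lemma ramp1 t c x : t < c -> x <= t -> ramp t c x = 1.
Proof.
move=> tc xt; rewrite /ramp /clamp (_ : Num.min _ _ = 1) ?(max_idPr ler01)//.
by apply/min_idPl; rewrite ler_pdivlMr ?subr_gt0// mul1r; lra.
Qed.

Lemma ramp0 t c x : t < c -> c <= x -> ramp t c x = 0.
Proof.
move=> tc cx; rewrite /ramp /clamp; apply/max_idPl; rewrite ge_min.
by apply/orP; right; rewrite pmulr_lle0 ?subr_le0// invr_gt0 subr_gt0.
Qed.

Lemma ramp_mid t c x : t <= x <= c -> t < c -> ramp t c x = (c - x) / (c - t).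
Proof.
move=> txc tc; rewrite /ramp clamp_id//; apply/andP; split.
  by apply: divr_ge0; lra.
by rewrite ler_pdivrMr ?subr_gt0// mul1r; lra.
Qed.

Lemma ramp_shift t s c x : t < s < c ->
  ramp s c x <= ramp t c x + (s - t) / (c - t).
Proof.
move=> /andP[ts sc]; have tc := lt_trans ts sc.
have d0 : 0 < c - t by rewrite subr_gt0.
have q0 : 0 <= (s - t) / (c - t) by rewrite divr_ge0 ?subr_ge0 ?ltW.
have [cx|xc] := leP c x; first by rewrite !ramp0// add0r.
have [xt|tx] := leP x t.
  by rewrite (ramp1 tc xt); have /andP[_ ?] := ramp01 s c x; lra.
have -> : ramp t c x = (c - x) / (c - t) by apply: ramp_mid => //; lra.
rewrite -mulrDl; have [xs|sx] := leP x s.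
  have /andP[_ /le_trans] := ramp01 s c x; apply.
  by rewrite ler_pdivlMr// mul1r; lra.
have -> : ramp s c x = (c - x) / (c - s) by apply: ramp_mid => //; lra.
rewrite ler_pdivrMr ?subr_gt0// mulrAC ler_pdivlMr//.
(* After clearing denominators the two sides differ by exactly this product. *)
have : 0 <= (s - t) * (x - s) by rewrite mulr_ge0 ?subr_ge0 ?ltW.
nra.
Qed.

Lemma le_ramp t c c' x : t < c -> c < c' -> ramp t c x <= ramp c c' x.
Proof.
move=> tc cc'; have [cx|xc] := leP c x.
  by rewrite (ramp0 tc cx); have /andP[] := ramp01 c c' x.
by rewrite (ramp1 cc' (ltW xc)); have /andP[] := ramp01 t c x.
Qed.

Context d (T : measurableType d) (m : probability T R) (X : T -> R)
  (mX : measurable_fun setT X).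

Lemma le_measure_Rintegral (A : set T) (f : T -> R) M : measurable A ->
  measurable_fun setT f -> (forall x, 0 <= f x <= M) ->
  (forall x, A x -> 1 <= f x) -> fine (m A) <= \int[m]_x f x.
Proof.
move=> mA mf fM Af.
have intf D : measurable D -> m.-integrable D (EFin \o f).
  move=> mD; apply: (@bounded_integrable _ _ _ m D f M) => // x.
  by have /andP[f0 fM'] := fM x; rewrite ger0_norm.
rewrite -(setUv A) Rintegral_setU ?setUv//; last 3 first.
- exact: measurableC.
- exact: intf.
- by apply/disj_setPS => h [].
rewrite -[leLHS]mul1r -(Rintegral_cst m mA) -[leLHS]addr0 lerD//.
  apply: le_Rintegral => //; last exact: intf.
  by apply: (@bounded_integrable _ _ _ m A (cst 1) `|1|) => //.
by apply: Rintegral_ge0 => x _; have /andP[] := fM x.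
Qed.

Lemma Rintegral_le_measure (A : set T) (f : T -> R) : measurable A ->
  measurable_fun setT f -> (forall x, 0 <= f x <= 1) ->
  (forall x, ~ A x -> f x = 0) -> \int[m]_x f x <= fine (m A).
Proof.
move=> mA mf f01 Af.
have intf D : measurable D -> m.-integrable D (EFin \o f).
  move=> mD; apply: (@bounded_integrable _ _ _ m D f 1) => // x.
  by have /andP[f0 fM'] := f01 x; rewrite ger0_norm.
rewrite -(setUv A) Rintegral_setU ?setUv//; last 3 first.
- exact: measurableC.
- exact: intf.
- by apply/disj_setPS => h [].
rewrite [X in _ + X](_ : _ = 0); last first.
  rewrite (@eq_Rintegral _ _ _ _ _ (fun=> 0)).
    by rewrite Rintegral_cst ?mul0r//; exact: measurableC.
  by move=> x; rewrite inE => /Af.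
rewrite addr0 -[leRHS]mul1r -(Rintegral_cst m mA).
apply: le_Rintegral => //; first exact: intf.
  by apply: (@bounded_integrable _ _ _ m A (cst 1) `|1|) => //.
by move=> x _; have /andP[] := f01 x.
Qed.

Lemma Rintegral_ramp t c : t < c ->
  fine (m (X @^-1` `]-oo, t])) <= \int[m]_x ramp t c (X x) <=
  fine (m (X @^-1` `]-oo, c[)).
Proof.
move=> tc.
have mr : measurable_fun setT (fun x => ramp t c (X x)).
  by apply: measurableT_comp mX; apply: continuous_measurable; case: (ramp_bc t c).
have mI (i : interval R) : measurable (X @^-1` [set` i]).
  by rewrite -[X in measurable X]setTI; apply: mX => //; exact: measurable_itv.
apply/andP; split.
  apply: (@le_measure_Rintegral _ _ 1) => // [x|x /=]; first exact: ramp01.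
  by rewrite in_itv/= => xt; rewrite ramp1.
apply: Rintegral_le_measure => // [x|x /=]; first exact: ramp01.
by rewrite in_itv/= => /negP; rewrite -leNgt => cx; rewrite ramp0.
Qed.

End ramp.

Section determined_by_continuous_functions.
Context {R : realType}.

Let mval : measurable_fun setT ((fun x => \val x) : borel (I01 R) -> R).
Proof. by apply: continuous_borel; exact: continuous_val. Qed.

(** The image laws on the line are compared on half-lines, a pi-system. The mass below
    [t - n.+1%:R^-1] is at most the mean of a ramp, common to both measures, and this mean is at
    most the other mass below [t]; continuity from below and symmetry conclude. *)
Lemma eq_probability_I01 (m1 m2 : probability (borel (I01 R)) R) :
  (forall f : R -> R, bounded_continuous f ->
    \int[m1]_x f (\val x) = \int[m2]_x f (\val x)) ->
  forall A : set (borel (I01 R)), measurable A -> m1 A = m2 A.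
Proof.
move=> m12.
have mtoI01 : measurable_fun setT ((@toI01 R) : R -> borel (I01 R)).
  apply: measurable_from_open => A oA; apply: open_measurable.
  by have /continuousP := @continuous_toI01 R; apply.
suff main (B : set R) : measurable B -> m1 (\val @^-1` B) = m2 (\val @^-1` B).
  move=> A mA; have -> : A = \val @^-1` ((@toI01 R) @^-1` A).
    by apply/seteqP; split => x /=; rewrite toI01K.
  by apply: main; rewrite -[X in measurable X]setTI; exact: mtoI01.
have mI (i : interval R) : measurable (\val @^-1` [set` i] : set (borel (I01 R))).
  by rewrite -[X in measurable X]setTI; apply: mval => //; exact: measurable_itv.
have half_line (p1 p2 : probability (borel (I01 R)) R) t :
    (forall f : R -> R, bounded_continuous f ->
      \int[p1]_x f (\val x) = \int[p2]_x f (\val x)) ->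
    (p1 (\val @^-1` `]-oo, t[) <= p2 (\val @^-1` `]-oo, t[))%E.
  move=> p12.
  pose A n : set (borel (I01 R)) := \val @^-1` `]-oo, (t - n.+1%:R^-1)[%classic.
  have mA n : measurable (A n) by exact: (mI `]-oo, (t - n.+1%:R^-1)[).
  have mt : measurable (\val @^-1` `]-oo, t[ : set (borel (I01 R))).
    exact: (mI `]-oo, t[).
  have UA : \val @^-1` `]-oo, t[ = \bigcup_n A n.
    apply/seteqP; split => x /=; last first.
      move=> [n _]; rewrite /A/= !in_itv/= => /lt_trans; apply.
      by rewrite ltrBlDr ltrDl invr_gt0.
    rewrite in_itv/= => xt; have tx0 : 0 < t - \val x by rewrite subr_gt0.
    have [n _ /(_ n (leqnn n))] := near_infty_natSinv_lt (PosNum tx0).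
    by move=> h; exists n => //; rewrite /A/= in_itv/= ltrBrDr -ltrBrDl.
  have cvgA : p1 \o A @ \oo --> p1 (\bigcup_n A n).
    apply: nondecreasing_cvg_mu => //; first exact: bigcupT_measurable.
    move=> n k nk; apply/subsetPset => x; rewrite /A/= !in_itv/= => /lt_le_trans.
    by apply; rewrite lerD2l lerN2 lef_pV2 ?posrE// ler_nat.
  rewrite UA; apply: (closed_cvg (fun y => (y <= p2 (\bigcup_n A n))%E) _ _ _ cvgA).
    exact: closed_ereal_ge_ereal.
  apply: nearW => n /=; rewrite -UA.
  have tn : t - n.+1%:R^-1 < t by rewrite ltrBlDr ltrDl invr_gt0.
  have /andP[h1 _] := Rintegral_ramp p1 mval tn.
  have /andP[_ h2] := Rintegral_ramp p2 mval tn.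
  rewrite -[leLHS]fineK ?fin_num_measure// -[leRHS]fineK ?fin_num_measure//.
  rewrite lee_fin; apply: le_trans h2; rewrite -p12; last exact: ramp_bc.
  have mA' := mI `]-oo, (t - n.+1%:R^-1)].
  apply: le_trans h1; rewrite fine_le ?fin_num_measure//.
  apply: le_measure; rewrite ?inE//.
  by move=> x; rewrite /A/= !in_itv/= => /ltW.
move=> mB.
have lawE' (p : probability (borel (I01 R)) R) : p (\val @^-1` B) = law p mval B by [].
rewrite !lawE'; move: B mB {lawE'}.
apply: (@measure_unique _ _ _ (@RGenInftyO.G R) (fun n => `]-oo, n%:R[%classic)).
- exact: RGenInftyO.measurableE.
- move=> _ _ [x ->] [y ->]; exists (Num.min x y).
  by apply/seteqP; split => z /=; rewrite !in_itv/= lt_min => /andP.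
- by move=> n; exists n%:R.
- apply/seteqP; split => // x _; exists (Num.bound `|x|) => //=.
  by rewrite in_itv/= (le_lt_trans (ler_norm x))// archi_boundP.
- move=> _ [x ->]; apply/eqP; rewrite eq_le; apply/andP.
  by split; apply: half_line => f bf; rewrite m12.
- by move=> n; rewrite (le_lt_trans (probability_le1 _ _)) ?ltry.
Qed.

End determined_by_continuous_functions.

(** * Riesz representation on [0,1] *)

Section riesz.
Context {R : realType}.

Record mean (L : (R -> R) -> R) : Prop := {
  meanD : forall f h, bounded_continuous f -> bounded_continuous h ->
    L (fun x => f x + h x) = L f + L h ;
  meanZ : forall c f, bounded_continuous f -> L (fun x => c * f x) = c * L f ;
  mean_bounds : forall f a b, bounded_continuous f -> bounds01 f a b ->
    a <= L f <= b }.

Section mean.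
Variables (L : (R -> R) -> R) (mL : mean L).

Lemma mean_cst c : L (fun=> c) = c.
Proof.
apply/eqP; rewrite eq_le andbC; apply: (mean_bounds mL).
  exact: bounded_continuous_cst.
by move=> x _; rewrite lexx.
Qed.

Lemma mean_sum n (F : nat -> R -> R) : (forall i, bounded_continuous (F i)) ->
  L (fun x => \sum_(i < n) F i x) = \sum_(i < n) L (F i).
Proof.
move=> bF; elim: n => [|n IH].
  by rewrite big_ord0; under eq_fun do rewrite big_ord0; exact: mean_cst.
under eq_fun do rewrite big_ord_recr/=.
by rewrite (meanD mL) ?IH ?big_ord_recr//; exact: bounded_continuous_sum.
Qed.

Lemma meanB f h : bounded_continuous f -> bounded_continuous h ->
  L (fun x => f x - h x) = L f - L h.
Proof.
move=> bf bh; have -> : (fun x => f x - h x) = (fun x => f x + -1 * h x).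
  by apply/funext => x; rewrite mulN1r.
by rewrite (meanD mL)// ?(meanZ mL)// ?mulN1r//; exact: bounded_continuousZ.
Qed.

Lemma mean_close f h eps : bounded_continuous f -> bounded_continuous h ->
  (forall x, 0 <= x <= 1 -> `|f x - h x| <= eps) -> `|L f - L h| <= eps.
Proof.
move=> bf bh fh; rewrite ler_norml -meanB//.
apply: (mean_bounds mL); first exact: bounded_continuousB.
by move=> x /fh; rewrite ler_norml.
Qed.

Lemma le_mean f h : bounded_continuous f -> bounded_continuous h ->
  (forall x, f x <= h x) -> L f <= L h.
Proof.
move=> bf bh fh; rewrite -subr_ge0 -meanB//.
have [_ [M hM]] := bounded_continuousB bh bf.
have b0M : bounds01 (fun x => h x - f x) 0 M.
  by move=> x _; rewrite subr_ge0 fh/= (le_trans (ler_norm _) (hM x)).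
by have /andP[] := mean_bounds mL (bounded_continuousB bh bf) b0M.
Qed.

Lemma mean_ramp01 t c : 0 <= L (ramp t c) <= 1.
Proof.
by apply: (mean_bounds mL); [exact: ramp_bc|move=> x _; exact: ramp01].
Qed.

(** The distribution function of the measure that will represent [L]; ramps with right corners
    beyond [t] make it right-continuous. *)
Definition mean_cdf t := inf [set L (ramp t c) | c in [set c | t < c]].

Let has_inf_cdf t : has_inf [set L (ramp t c) | c in [set c | t < c]].
Proof.
split; first by exists (L (ramp t (t + 1))), (t + 1) => //=; rewrite ltrDl.
by exists 0 => _ [c _ <-]; have /andP[] := mean_ramp01 t c.
Qed.

Lemma mean_cdf_ramp t c : t < c -> mean_cdf t <= L (ramp t c) <= mean_cdf c.
Proof.
move=> tc; apply/andP; split.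
  by apply: (ge_inf (has_inf_cdf t).2); exists c.
apply: lb_le_inf; first by case: (has_inf_cdf c).
move=> _ [c' /= cc' <-]; apply: le_mean; [exact: ramp_bc|exact: ramp_bc|].
by move=> x; exact: le_ramp.
Qed.

Lemma mean_cdf_nondecreasing : nondecreasing mean_cdf.
Proof.
move=> s t; rewrite le_eqVlt => /predU1P[->//|st].
by have /andP[] := mean_cdf_ramp st; exact: le_trans.
Qed.

Lemma mean_cdf_lt0 t : t < 0 -> mean_cdf t = 0.
Proof.
move=> t0; apply/eqP; rewrite eq_le; apply/andP; split.
  have /andP[/le_trans h _] := mean_cdf_ramp t0; apply: h.
  have r0 : bounds01 (ramp t 0) 0 0.
    by move=> x /andP[x0 _]; rewrite ramp0// lexx.
  by have /andP[] := mean_bounds mL (ramp_bc t 0) r0.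
apply: lb_le_inf; first by case: (has_inf_cdf t).
by move=> _ [c _ <-]; have /andP[] := mean_ramp01 t c.
Qed.

Lemma mean_cdf_ge1 t : 1 <= t -> mean_cdf t = 1.
Proof.
move=> t1; apply/eqP; rewrite eq_le; apply/andP; split.
  have tt1 : t < t + 1 by rewrite ltrDl.
  have /andP[/le_trans h _] := mean_cdf_ramp tt1; apply: h.
  by have /andP[] := mean_ramp01 t (t + 1).
apply: lb_le_inf; first by case: (has_inf_cdf t).
move=> _ [c /= tc <-].
have r1 : bounds01 (ramp t c) 1 1.
  by move=> x /andP[_ x1]; rewrite ramp1 ?lexx// (le_trans x1).
by have /andP[] := mean_bounds mL (ramp_bc t c) r1.
Qed.

Lemma mean_cdf_right_continuous x : mean_cdf y @[y --> x^'+] --> mean_cdf x.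
Proof.
apply/cvgrPdist_le => eps eps0.
have e20 : 0 < eps / 2 by rewrite divr_gt0.
have [_ [c /= xc <-] Lc] := inf_adherent e20 (has_inf_cdf x).
have d0 : 0 < c - x by rewrite subr_gt0.
near=> s.
have xs : x < s by near: s; exact: nbhs_right_gt.
have sc : s < c by near: s; exact: nbhs_right_lt.
(* With this choice moving the left corner of the ramp from [x] to [s] costs at most [eps / 2]. *)
have se : s < x + (c - x) * (eps / 2).
  by near: s; apply: nbhs_right_lt; rewrite ltrDl mulr_gt0.
have h1 := mean_cdf_nondecreasing (ltW xs).
rewrite distrC ger0_norm ?subr_ge0// lerBlDl.
have /andP[h2 _] := mean_cdf_ramp sc.
apply: le_trans h2 _.
have h3 : L (ramp s c) <= L (fun y => ramp x c y + (s - x) / (c - x)).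
  apply: le_mean; [exact: ramp_bc| |].
    by apply: bounded_continuousD; [exact: ramp_bc|exact: bounded_continuous_cst].
  by move=> y; apply: ramp_shift; rewrite xs.
apply: le_trans h3 _.
rewrite (meanD mL); [|exact: ramp_bc|exact: bounded_continuous_cst].
rewrite mean_cst; have h5 : (s - x) / (c - x) <= eps / 2.
  by rewrite ler_pdivrMr// mulrC; lra.
by rewrite /mean_cdf in Lc *; lra.
Unshelve. all: by end_near. Qed.

End mean.

(** The sum is the piecewise linear interpolant of [f] at the nodes. In each cell one ramp is
    active, and the value is a convex combination of [f] at the two ends. Using [n.+2] cells makes
    the mesh strictly smaller than [1 / n.+1]. *)
Lemma sum_ramp (f : R -> R) n eps :
  (forall x y, 0 <= x <= 1 -> `|x - y| < n.+1%:R^-1 -> `|f x - f y| <= eps) ->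
  let t (i : nat) : R := i%:R / n.+2%:R in
  forall x, 0 <= x <= 1 ->
  `|f x - (f 1 + \sum_(i < n.+2) (f (t i) - f (t i.+1)) * ramp (t i) (t i.+1) x)|
    <= eps.
Proof.
move=> feps t x /andP[x0 x1].
have n0 : 0 < n.+2%:R :> R by rewrite ltr0n.
have tt i : t i < t i.+1 by rewrite ltr_pM2r ?invr_gt0// ltr_nat.
have tle i j : (i <= j)%N -> t i <= t j.
  by move=> ij; rewrite ler_pM2r ?invr_gt0// ler_nat.
have tS i : t i.+1 - t i < n.+1%:R^-1.
  by rewrite -mulrBl -natrB// subSnn mul1r ltf_pV2 ?posrE ?ltr0n// ltr_nat.
have x01 : 0 <= x <= 1 by rewrite x0.
have -> : 1 = t n.+2 by rewrite /t divff// gt_eqF.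
suff main k : (t k <= x ->
     \sum_(i < k) (f (t i) - f (t i.+1)) * ramp (t i) (t i.+1) x = 0) /\
    (x <= t k -> `|f x - (f (t k) +
     \sum_(i < k) (f (t i) - f (t i.+1)) * ramp (t i) (t i.+1) x)| <= eps).
  by apply: (main n.+2).2; rewrite /t divff// gt_eqF.
split.
  move=> tx; apply: big1 => i _; rewrite ramp0 ?mulr0//.
  by rewrite (le_trans _ tx)// tle.
elim: k => [|k IH] xt.
  rewrite big_ord0 addr0; apply: feps => //.
  have -> : x = 0 by apply/eqP; rewrite eq_le x0 andbT (le_trans xt)// /t mul0r.
  by rewrite /t mul0r subrr normr0 invr_gt0.
rewrite big_ord_recr/=; set S := \sum_(i < k) _ in IH *.
have [xk|kx] := leP x (t k).
  rewrite (ramp1 (tt k) xk) mulr1.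
  by rewrite (_ : f (t k.+1) + _ = f (t k) + S); [exact: IH|ring].
have -> : S = 0.
  apply: big1 => i _; rewrite ramp0 ?mulr0//.
  by rewrite (le_trans _ (ltW kx))// tle.
set r := ramp _ _ _; have /andP[r0 r1] : 0 <= r <= 1 := ramp01 _ _ _.
have h1 : `|f x - f (t k)| <= eps.
  apply: feps => //; rewrite ger0_norm ?subr_ge0 ?ltW//.
  by apply: le_lt_trans (tS k); rewrite lerD2r.
have h2 : `|f x - f (t k.+1)| <= eps.
  apply: feps => //; rewrite distrC ger0_norm ?subr_ge0//.
  by apply: le_lt_trans (tS k); rewrite lerD2l lerN2 ltW.
rewrite (_ : f x - _ = r * (f x - f (t k)) + (1 - r) * (f x - f (t k.+1))); last by ring.
rewrite (le_trans (ler_normD _ _))// !normrM (ger0_norm r0).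
rewrite (ger0_norm (_ : 0 <= 1 - r)) ?subr_ge0//.
have -> : eps = r * eps + (1 - r) * eps by ring.
by rewrite lerD// ler_wpM2l// subr_ge0.
Qed.

(* Summation by parts: on a fine grid f is close to a combination of ramps
   whose coefficients are its increments. *)
Lemma eq_mean (L1 L2 : (R -> R) -> R) (F : R -> R) : mean L1 -> mean L2 ->
  (forall t, 0 <= F t <= 1) ->
  (forall t c, 0 <= t -> t < c -> c <= 1 ->
    F t <= L1 (ramp t c) <= F c /\ F t <= L2 (ramp t c) <= F c) ->
  forall f, bounded_continuous f -> L1 f = L2 f.
Proof.
move=> m1 m2 F01 LF f bf.
suff main eps : 0 < eps -> `|L1 f - L2 f| <= 3 * eps.
  apply/eqP; rewrite -subr_eq0 -normr_le0; apply/ler_addgt0Pr => eps eps0.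
  rewrite add0r; have e30 : 0 < eps / 3 by rewrite divr_gt0.
  by apply: le_trans (main _ e30) _; lra.
move=> eps0; have [cf _] := bf; have [n hn] := uniform_continuity01 cf eps0.
pose t (i : nat) : R := i%:R / n.+2%:R.
pose S x := f 1 + \sum_(i < n.+2) (f (t i) - f (t i.+1)) * ramp (t i) (t i.+1) x.
have n0 : 0 < n.+2%:R :> R by rewrite ltr0n.
have tt i : t i < t i.+1 by rewrite ltr_pM2r ?invr_gt0// ltr_nat.
have t0 i : 0 <= t i by rewrite divr_ge0.
have t1 i : (i <= n.+2)%N -> t i <= 1.
  by move=> iN; rewrite ler_pdivrMr// mul1r ler_nat.
have fS x : 0 <= x <= 1 -> `|f x - S x| <= eps.
  by apply: sum_ramp => u v u01 uv; exact: ltW (hn _ _ u01 uv).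
have bt i : bounded_continuous (fun x => (f (t i) - f (t i.+1)) * ramp (t i) (t i.+1) x).
  by apply: bounded_continuousZ; exact: ramp_bc.
have b1 := @bounded_continuous_cst R (f 1).
have bsum : bounded_continuous
    (fun x => \sum_(i < n.+2) (f (t i) - f (t i.+1)) * ramp (t i) (t i.+1) x).
  exact: (bounded_continuous_sum _ bt).
have bS : bounded_continuous S by exact: bounded_continuousD.
have LS L : mean L -> L S = f 1 +
    \sum_(i < n.+2) (f (t i) - f (t i.+1)) * L (ramp (t i) (t i.+1)).
  move=> mL; rewrite /S (meanD mL)// (mean_cst mL) (mean_sum mL _ bt); congr (_ + _).
  by apply: eq_bigr => i _; rewrite (meanZ mL)//; exact: ramp_bc.
have h1 := mean_close m1 bf bS fS.
have h2 := mean_close m2 bf bS fS.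
have h3 : `|L1 S - L2 S| <= eps.
  rewrite !LS// opprD addrACA subrr add0r -sumrB.
  rewrite (le_trans (ler_norm_sum _ _ _))//.
  (* Both means of the ramp of index [i] lie in [F (t i), F (t i.+1)]; these lengths add up to at
     most 1, however many ramps there are. *)
  apply: (@le_trans _ _ (\sum_(i < n.+2) eps * (F (t i.+1) - F (t i)))).
    apply: ler_sum => i _; rewrite -mulrBr normrM ler_pM//.
      apply: ltW; apply: hn; first by rewrite t0 t1// ltnW.
      rewrite distrC ger0_norm ?subr_ge0 ?(ltW (tt i))// -mulrBl -natrB// subSnn mul1r.
      by rewrite ltf_pV2 ?posrE ?ltr0n// ltr_nat.
    have [/andP[? ?] /andP[? ?]] := LF _ _ (t0 i) (tt i) (t1 i.+1 (ltn_ord i)).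
    by rewrite ler_norml; lra.
  rewrite -mulr_sumr -(big_mkord xpredT (fun i => F (t i.+1) - F (t i))).
  rewrite (telescope_sumr (fun i => F (t i)))//; apply: ler_piMr; first exact: ltW.
  by have /andP[? ?] := F01 (t n.+2); have /andP[? ?] := F01 (t 0%N); lra.
rewrite (_ : L1 f - L2 f = (L1 f - L1 S) + ((L1 S - L2 S) - (L2 f - L2 S))); last by ring.
rewrite (le_trans (ler_normD _ _))//.
have := ler_normB (L1 S - L2 S) (L2 f - L2 S); lra.
Qed.

(** The measure is the Lebesgue-Stieltjes measure of [mean_cdf L], carried to [0,1] by [toI01];
    [eq_mean] identifies its integral with [L]. *)
Lemma riesz_I01 (L : (R -> R) -> R) : mean L ->
  exists nu : probability (borel (I01 R)) R, forall f, bounded_continuous f ->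
    \int[nu]_x f (\val x) = L f.
Proof.
move=> mL; pose F := mean_cdf L.
have FNy : F @ -oo --> (0 : R).
  apply: cvg_near_cst; exists 0; split; first exact: num_real.
  by move=> t /= t0; exact: (mean_cdf_lt0 mL t0).
have Fy : F @ +oo --> (1 : R).
  apply: cvg_near_cst; exists 1; split; first exact: num_real.
  by move=> t /= t1; exact: (mean_cdf_ge1 mL (ltW t1)).
pose Fc : cumulativeBounded (0 : R) (1 : R) := HB.pack F
  (isCumulative.Build _ _ _ F (mean_cdf_nondecreasing mL) (mean_cdf_right_continuous mL))
  (isCumulativeBounded.Build _ 0 1 F FNy Fy).
pose m : probability (measurableTypeR R) R := lebesgue_stieltjes_measure Fc.
have mF (r : R) : m `]-oo, r]%classic = (F r)%:E.
  exact: (cdf_lebesgue_stieltjes_id Fc r).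
have mt : measurable_fun setT ((@toI01 R) : measurableTypeR R -> borel (I01 R)).
  apply: measurable_from_open => A oA; apply: open_measurable.
  by have /continuousP := @continuous_toI01 R; apply.
have mc : measurable_fun setT (@clamp R : measurableTypeR R -> R).
  exact: continuous_measurable (@continuous_clamp R).
exists (law m mt) => f bf.
have [cf0 [M fM]] := bf.
have mv : measurable_fun setT ((fun x => f (\val x)) : borel (I01 R) -> R).
  apply: continuous_borel => x; apply: (@continuous_comp (I01 R) R R (fun x => \val x) f).
    exact: continuous_val.
  exact: cf0.
rewrite (Rintegral_law m mt mv (fun x => fM _)); apply/esym.
pose L2 (h : R -> R) := \int[m]_x h (clamp x).
have mh h : bounded_continuous h ->
    measurable_fun setT (fun x : measurableTypeR R => h (clamp x)).
  by move=> [ch _]; exact: (measurableT_comp (continuous_measurable ch) mc).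
have ih h : bounded_continuous h -> m.-integrable setT (EFin \o (fun x => h (clamp x))).
  move=> bh; have [_ [N hN]] := bh.
  by apply: (@bounded_integrable _ _ _ m setT _ N) => //; exact: mh.
have m2 : mean L2.
  split.
  - by move=> g h bg bh; apply: (RintegralD measurableT); exact: ih.
  - by move=> c h bh; apply: (RintegralZl _ measurableT); exact: ih.
  - move=> h a b bh hab.
    have := @Rintegral_bounds _ _ _ m setT (fun x => h (clamp x)) a b measurableT
      (mh _ bh).
    have -> : fine (m setT) = 1 by rewrite probability_setT.
    by rewrite !mulr1; apply => x; apply: hab; exact: clamp01.
apply: (@eq_mean L L2 F) => //.
  move=> t; apply/andP; split.
    apply: lb_le_inf; first by exists (L (ramp t (t + 1))), (t + 1) => //=; rewrite ltrDl.
    by move=> _ [c _ <-]; have /andP[] := mean_ramp01 mL t c.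
  have tt1 : t < t + 1 by rewrite ltrDl.
  have /andP[/le_trans h _] := mean_cdf_ramp mL tt1; apply: h.
  by have /andP[] := mean_ramp01 mL t (t + 1).
move=> t c t0 tc c1; split; first exact: mean_cdf_ramp.
have mI (i : interval R) : measurable (@clamp R @^-1` [set` i] : set (measurableTypeR R)).
  by rewrite -[X in measurable X]setTI; apply: mc => //; exact: measurable_itv.
have mi r : measurable (`]-oo, r]%classic : set (measurableTypeR R)).
  exact: measurable_itv.
have /andP[h1 h2] := Rintegral_ramp m mc tc.
have Fm (r : R) : F r = fine (m `]-oo, r]%classic) by rewrite mF.
apply/andP; split.
  apply: le_trans h1; have mt1 := mI `]-oo, t].
  rewrite Fm fine_le ?fin_num_measure//; apply: le_measure; rewrite ?inE//.
  (* As [0 <= t], clamping maps ]-oo, t] into itself. In the last inclusion [c <= 1] ensures that a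
     clamped value below [c] comes from a point below [c]. *)
  move=> x /=; rewrite !in_itv/= => xt.
  by rewrite /clamp ge_max t0/= ge_min xt orbT.
apply: le_trans h2 _; have mc1 := mI `]-oo, c[.
rewrite Fm fine_le ?fin_num_measure//; apply: le_measure; rewrite ?inE//.
move=> x /=; rewrite !in_itv/= /clamp gt_max gt_min => /andP[_ /orP[|/ltW//]].
by rewrite ltNge c1.
Qed.

End riesz.

(** * Stationary measures *)

Section ergodic_mean.
Context {R : realType} {U : (R -> R) -> R -> R} (mU : markov_operator U).
Implicit Types f h : R -> R.

Context (osc01 : forall f, bounded_continuous f -> bounds01 f 0 1 ->
  forall eta, 0 < eta -> exists N0, forall N, (N0 <= N)%N ->
    forall x y, 0 <= x <= 1 -> 0 <= y <= 1 ->
    cesaro U N f x - cesaro U N f y <= eta).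

Lemma oscillation_bounded_continuous f : bounded_continuous f ->
  forall eta, 0 < eta -> exists N0, forall N, (N0 <= N)%N ->
    forall x y, 0 <= x <= 1 -> 0 <= y <= 1 ->
    cesaro U N f x - cesaro U N f y <= eta.
Proof.
move=> bf eta eta0; have [_ [M fM]] := bf.
have M0 : 0 <= M by exact: le_trans (fM 0).
(* [c * (f + M)] has values in [0,1]; the added 1 keeps the divisor positive when [M] is 0. *)
pose c := (2 * M + 1)^-1; have M1 : 0 < 2 * M + 1 by lra.
have c0 : 0 < c by rewrite invr_gt0.
have bM := @bounded_continuous_cst R M.
have bg := bounded_continuousZ c (bounded_continuousD bf bM).
have g01 : bounds01 (fun x => c * (f x + M)) 0 1.
  move=> x _; have := fM x; rewrite ler_norml => /andP[f1 f2].
  apply/andP; split; first by apply: mulr_ge0; [exact: ltW|lra].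
  by rewrite ler_pdivrMl// mulr1; lra.
have [N0 hN] := osc01 bg g01 (mulr_gt0 c0 eta0).
exists N0 => N /hN h x y x01 y01; have := h x y x01 y01.
rewrite !(cesaroZ mU)//; try exact: bounded_continuousD.
rewrite !(cesaroD mU)// !(cesaro_cst mU)// -mulrBr ler_pM2l//; lra.
Qed.

Lemma cesaro_comm N K f x : bounded_continuous f -> 0 <= x <= 1 ->
  cesaro U N (cesaro U K f) x = cesaro U K (cesaro U N f) x.
Proof.
move=> bf x01.
have bsum := @bounded_continuous_sum _ N.+1 (fun k => iter k U f)
  (fun k => iter_bc mU k bf).
have -> : cesaro U K (cesaro U N f) x =
    N.+1%:R^-1 * \sum_(j < N.+1) cesaro U K (iter j U f) x.
  rewrite -[LHS]/(cesaro U K (fun y => N.+1%:R^-1 * _) x) (cesaroZ mU)//; congr (_ * _).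
  rewrite {1}/cesaro.
  under eq_bigr => k _ do
    rewrite (iter_sum mU k N.+1 (fun j => iter_bc mU j bf) x01).
  by rewrite exchange_big/= mulr_sumr; apply: eq_bigr.
rewrite {1}/cesaro; congr (_ * _); apply: eq_bigr => j _.
exact: iter_cesaro.
Qed.

Lemma cesaro_near N K f eta : bounded_continuous f ->
  (forall x y, 0 <= x <= 1 -> 0 <= y <= 1 -> cesaro U N f x - cesaro U N f y <= eta) ->
  `|cesaro U K (cesaro U N f) 0 - cesaro U N f 0| <= eta.
Proof.
move=> bf osc; have z01 : 0 <= (0 : R) <= 1 by rewrite lexx ler01.
set v := cesaro U N f in osc *.
have vb : bounds01 v (v 0 - eta) (v 0 + eta).
  move=> x x01; have := osc _ _ x01 z01; have := osc _ _ z01 x01; lra.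
have := cesaro_bounds mU K (cesaro_bc mU N bf) vb z01.
by rewrite -/v ler_norml => /andP[? ?]; lra.
Qed.

(** Cesaro operators commute, so for large [N] both single means at 0 are close to the same double
    mean with orders [N0] and [N], because averaging an almost constant function hardly changes
    it. *)
Lemma cvg_cesaro f : bounded_continuous f ->
  cvg (cesaro U N f 0 @[N --> \oo]).
Proof.
move=> bf; apply/cauchy_cvgP; apply/cauchyP => eps eps0.
have e20 : 0 < eps / 3 by rewrite divr_gt0.
have [N0 hN] := oscillation_bounded_continuous bf e20.
exists (cesaro U N0 f 0); exists N0 => // N /= NN0.
rewrite /ball/=; have z01 : 0 <= (0 : R) <= 1 by rewrite lexx ler01.
have h1 := cesaro_near N bf (hN N0 (leqnn _)).
have h2 := cesaro_near N0 bf (hN N NN0).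
rewrite (cesaro_comm N0 N bf z01) in h2.
move: h1 h2; rewrite !ler_norml ltr_norml => /andP[? ?] /andP[? ?]; lra.
Qed.

Definition ergodic_mean f := lim (cesaro U N f 0 @[N --> \oo]).

Lemma cvg_ergodic_mean f : bounded_continuous f ->
  cesaro U N f 0 @[N --> \oo] --> ergodic_mean f.
Proof. by move=> bf; exact: cvg_cesaro. Qed.

Lemma mean_ergodic_mean : mean ergodic_mean.
Proof.
split.
- move=> f h bf bh; apply: cvg_lim => //.
  under eq_fun do rewrite (cesaroD mU)//.
  by apply: cvgD; exact: cvg_ergodic_mean.
- move=> c f bf; apply: cvg_lim => //.
  under eq_fun do rewrite (cesaroZ mU)//.
  by apply: cvgM; [exact: cvg_cst|exact: cvg_ergodic_mean].
- move=> f a b bf fab; have z01 : 0 <= (0 : R) <= 1 by rewrite lexx ler01.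
  apply/andP; split.
    apply: limr_ge; first exact: cvg_cesaro.
    by apply: nearW => N; have /andP[] := cesaro_bounds mU N bf fab z01.
  apply: limr_le; first exact: cvg_cesaro.
  by apply: nearW => N; have /andP[] := cesaro_bounds mU N bf fab z01.
Qed.

Lemma ergodic_mean_invariant f : bounded_continuous f ->
  ergodic_mean (U f) = ergodic_mean f.
Proof.
move=> bf; have bUf := markov_bc mU bf; have [_ [M fM]] := bf.
apply/eqP; rewrite -subr_eq0; apply/eqP.
have z01 : 0 <= (0 : R) <= 1 by rewrite lexx ler01.
have h : (cesaro U N (U f) 0 - cesaro U N f 0) @[N --> \oo] -->
    ergodic_mean (U f) - ergodic_mean f.
  by apply: cvgB; exact: cvg_ergodic_mean.
rewrite -(cvg_lim (@Rhausdorff R) h); apply: cvg_lim => //.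
have fb : bounds01 f (- M) M by move=> x _; rewrite -ler_norml.
have cvg0 (c : R) : c * harmonic N @[N --> \oo] --> 0.
  by rewrite -[X in _ --> X](mulr0 c); apply: cvgM; [exact: cvg_cst|exact: cvg_harmonic].
have lim0 N : - (2 * M) * harmonic N <=
    cesaro U N (U f) 0 - cesaro U N f 0 <= 2 * M * harmonic N.
  rewrite cesaro_shift1 ![_ * harmonic N]mulrC /harmonic/=.
  rewrite !ler_pM2l ?invr_gt0 ?ltr0n//.
  have := iter_bounds mU N.+1 bf fb z01; have := fb 0 z01.
  by rewrite iterS; lra.
apply: (squeeze_cvgr _ (cvg0 (- (2 * M))) (cvg0 (2 * M))).
by apply: nearW => N; exact: lim0.
Qed.

(** An invariant [L] takes the same value on [f] and on its Cesaro means, which are almost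
    constant. *)
Lemma invariant_mean_unique (L : (R -> R) -> R) : mean L ->
  (forall f, bounded_continuous f -> L (U f) = L f) ->
  forall f, bounded_continuous f -> L f = ergodic_mean f.
Proof.
move=> mL LU f bf.
have LA N : L (cesaro U N f) = L f.
  rewrite -[LHS]/(L (fun y => N.+1%:R^-1 * _)) (meanZ mL); last first.
    exact: (@bounded_continuous_sum _ N.+1 (fun k => iter k U f)
      (fun k => iter_bc mU k bf)).
  rewrite (mean_sum mL N.+1 (fun k => iter_bc mU k bf)).
  have -> : \sum_(i < N.+1) L (iter i U f) = \sum_(i < N.+1) L f.
    apply: eq_bigr => i _; elim: (i : nat) => //= k IH.
    by rewrite LU//; exact: iter_bc.
  by rewrite sumr_const card_ord -(mulr_natl (L f)) mulKf.
have z01 : 0 <= (0 : R) <= 1 by rewrite lexx ler01.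
rewrite -(cvg_lim (@Rhausdorff R) (cvg_ergodic_mean bf)); apply/esym/cvg_lim => //.
apply/cvgrPdist_le => eps eps0.
have [N0 hN] := oscillation_bounded_continuous bf eps0.
exists N0 => // N /= /hN osc; rewrite -(LA N) ler_norml.
have vb : bounds01 (cesaro U N f) (cesaro U N f 0 - eps) (cesaro U N f 0 + eps).
  by move=> x x01; have := osc _ _ x01 z01; have := osc _ _ z01 x01; lra.
have := mean_bounds mL (cesaro_bc mU N bf) vb; lra.
Qed.

End ergodic_mean.

Section stationary_measures.
Context {R : realType}.
Context (mu : probability (borel (C01 R)) R) (mu1 : mu (msupport mu) = 1%E).
Local Notation U := (transfer (ev : borel (C01 R) -> R -> R) mu).

Let mval : measurable_fun setT ((fun x => \val x) : borel (I01 R) -> R).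
Proof. by apply: continuous_borel; exact: continuous_val. Qed.

Definition apply_map (z : borel (C01 R) * borel (I01 R)) : borel (I01 R) :=
  (z.1 : C01 R) z.2.

Lemma measurable_apply_map : measurable_fun setT apply_map.
Proof.
have mv : measurable_fun setT
    (fun z : borel (C01 R) * borel (I01 R) => ev z.1 (\val z.2)).
  apply: (@measurable_eval R _ _ (borel (C01 R) * borel (I01 R))%type
    (borel (C01 R)) ev fst (fun z => \val z.2) (@continuous_ev R)
    (@measurable_ev R) measurable_fst).
  exact: (measurableT_comp mval measurable_snd).
have mt : measurable_fun setT ((@toI01 R) : R -> borel (I01 R)).
  apply: measurable_from_open => A oA; apply: open_measurable.
  by have /continuousP := @continuous_toI01 R; apply.
have -> : apply_map = (@toI01 R) \o (fun z => ev z.1 (\val z.2)).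
  by apply/funext => z; rewrite /= ev_val toI01K.
exact: measurableT_comp mt mv.
Qed.

Definition push (nu : probability (borel (I01 R)) R) : probability (borel (I01 R)) R :=
  law (mu \x nu)%E measurable_apply_map.

(** The product measure integrates the masses of the sections; by [mu1] the maps outside the support
    are negligible. *)
Lemma pushE nu (A : set (borel (I01 R))) : measurable A ->
  push nu A = (\int[mu]_(g in msupport mu) nu ((g : C01 R) @^-1` A))%E.
Proof.
move=> mA.
have mA' : measurable (apply_map @^-1` A).
  by rewrite -[X in measurable X]setTI; exact: measurable_apply_map.
have mS := measurable_msupport mu.
have xE g : xsection (apply_map @^-1` A) g = (g : C01 R) @^-1` A.
  by apply/seteqP; split => x /=; rewrite /xsection/= inE.
transitivity (\int[mu]_g nu ((g : C01 R) @^-1` A))%E.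
  rewrite lawE /= /product_measure1; apply: eq_integral => g _ /=.
  by rewrite xE.
rewrite (@ge0_negligible_integral _ _ _ mu setT (~` msupport mu))//.
- by rewrite setTD setCK.
- exact: measurableC.
- have := measurable_fun_xsection nu mA'; apply: eq_measurable_fun => g _ /=.
  by rewrite xE.
- by apply: etrans (probability_setC mu mS) _; rewrite mu1 subee.
Qed.

Lemma stationaryE nu : stationary mu nu <->
  forall A : set (borel (I01 R)), measurable A -> push nu A = nu A.
Proof.
by split=> h A mA; [rewrite pushE//; exact/esym/h|rewrite -pushE//; exact/esym/h].
Qed.

Let comp_val f := (fun x : borel (I01 R) => f (\val x) : R).

Let mcomp f : bounded_continuous f -> measurable_fun setT (comp_val f).
Proof.
by move=> [cf _]; exact: (measurableT_comp (continuous_measurable cf) mval).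
Qed.

(** Duality between [push] and [U], from integrating over the map first. *)
Lemma Rintegral_push nu f : bounded_continuous f ->
  \int[push nu]_x f (\val x) = \int[nu]_x U f (\val x).
Proof.
move=> bf; have [_ [M fM]] := bf.
rewrite (Rintegral_law _ _ (mcomp bf) (fun x => fM _)).
have [_ ->] := @bounded_Fubini _ _ _ _ _ mu nu
  (fun z => comp_val f (apply_map z)) M
  (measurableT_comp (mcomp bf) measurable_apply_map) (fun z => fM _).
apply: eq_Rintegral => x _; rewrite /transfer; apply: eq_Rintegral => g _.
by rewrite /comp_val /apply_map/= ev_val.
Qed.

Lemma mean_Rintegral (nu : probability (borel (I01 R)) R) :
  mean (fun f => \int[nu]_x f (\val x)).
Proof.
have ih h : bounded_continuous h -> nu.-integrable setT (EFin \o (comp_val h)).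
  move=> bh; have [_ [N hN]] := bh.
  exact: (@bounded_integrable R _ (borel (I01 R)) nu setT (comp_val h) N
    measurableT (mcomp bh) (fun x => hN (\val x))).
split.
- by move=> g h bg bh; apply: (RintegralD measurableT); exact: ih.
- by move=> c h bh; apply: (RintegralZl _ measurableT); exact: ih.
- move=> h a b bh hab.
  have := @Rintegral_bounds _ _ _ nu setT (comp_val h) a b measurableT (mcomp bh).
  have -> : fine (nu setT) = 1 by rewrite probability_setT.
  by rewrite !mulr1; apply => x; apply: hab; exact: I01_itv.
Qed.

End stationary_measures.

Theorem corollary1p3 (R : realType) (mu : probability (borel (C01 R)) R)
    (P : probability (product_space (borel (C01 R))) R)
    (hP : is_power_measure mu P)
    (hTV : (0 < P (bounded_prefix_TV mu))%E)
    (U1 : forall x : I01 R, 0 < \val x < 1 ->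
      exists2 g : C01 R, msupport mu g & \val (g x) < \val x)
    (U2 : forall x : I01 R, 0 < \val x < 1 ->
      exists2 g : C01 R, msupport mu g & \val x < \val (g x))
    (hint : forall g : C01 R, msupport mu g ->
      forall x : I01 R, 0 < \val x < 1 -> 0 < \val (g x) < 1)
    (hend : exists g0 g1 : C01 R,
      [/\ msupport mu g0, msupport mu g1,
          0 < \val (g0 i0) < 1 & 0 < \val (g1 i1) < 1]) :
  uniquely_ergodic mu.
Proof.
have [g0 [g1 [g0S g1S g00 g11]]] := hend.
have h0 : exists2 g : C01 R, msupport mu g & 0 < \val (g i0) < 1 by exists g0.
have h1 : exists2 g : C01 R, msupport mu g & 0 < \val (g i1) < 1 by exists g1.
have osc := mean_oscillation hP hTV U1 hint h0 h1.
have mu1 := msupport_full hP hTV.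
have mU := @transfer_markov R _ (borel (C01 R)) ev (@continuous_ev R)
  (@measurable_ev R) (@ev01 R) mu.
(* Tested on continuous functions, stationarity of [nu] is the [U]-invariance of [ergodic_mean]; a
   stationary [nu'] likewise gives an invariant mean. *)
have [nu nuE] := riesz_I01 (mean_ergodic_mean mU osc).
exists nu.
  apply/(stationaryE mu1); apply: eq_probability_I01 => f bf.
  rewrite Rintegral_push// !nuE//; last exact: (markov_bc mU).
  exact: ergodic_mean_invariant.
move=> nu' /(stationaryE mu1) st'; apply: eq_probability_I01 => f bf.
rewrite nuE//; apply: (invariant_mean_unique mU osc (mean_Rintegral nu')) => // h bh.
by rewrite -Rintegral_push//; exact: eq_measure_Rintegral.
Qed.
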